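(* Let $n,k\ge0$ be integers. If $k\ne1$, the Clifford--Weyl algebra $\mathcal{C}(2n+1,2k)$ is rigid.
   Context: All algebras are unital associative over $\mathbb{C}$. For $n,k\ge 0$ the Clifford--Weyl algebra $\mathcal{C}(n,2k)$ is the algebra with generators $\omega_1,\dots,\omega_n,p_1,q_1,\dots,p_k,q_k$ and relations $\omega_i\omega_j+\omega_j\omega_i=2\delta_{ij}$; $p_iq_j-q_jp_i=\delta_{ij}$, $p_ip_j=p_jp_i$, $q_iq_j=q_jq_i$; $\omega_ip_j+p_j\omega_i=0$, $\omega_iq_j+q_j\omega_i=0$ for all $i,j$. A (formal) deformation of an algebra $A$ with formal parameter $\Lambda$ is an associative $\mathbb{C}[[\Lambda]]$-algebra structure $\star$ on $A[[\Lambda]]$ of the form $a\star b=ab+\sum_{m\ge1}\Lambda^m\Omega_m(a,b)$ for $a,b\in A$, with $\Omega_m:A\times A\to A$ bilinear. Two deformations are equivalent if there is an isomorphism of $\mathbb{C}[[\Lambda]]$-algebras between them which is the identity modulo $\Lambda$. $A$ is rigid if every deformation of $A$ is equivalent to the undeformed product extended $\mathbb{C}[[\Lambda]]$-bilinearly. *)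

(* Defs.v *)
From HB Require Import structures.
From mathcomp Require Import all_boot all_algebra.
From mathcomp Require Import finmap monalg.
From mathcomp Require Import boolp reals complex.

Set Implicit Arguments.
Unset Strict Implicit.
Unset Printing Implicit Defensive.

Import GRing.Theory.
Local Open Scope ring_scope.

(* [fps V] is V[[Lambda]]; [coefs f m] is the coefficient of Lambda^m.        *)
Record fps (V : Type) : Type := Fps { coefs : nat -> V }.
HB.instance Definition _ (V : Type) := [isNew for @coefs V].
HB.instance Definition _ (V : choiceType) := [Choice of fps V by <:].

Lemma fpsP (V : Type) (f g : fps V) : coefs f =1 coefs g <-> f = g.
Proof.
by split=> [|->//]; case: f g => [f] [g] /= fg; congr Fps; apply/funext.
Qed.

Section Zmodule.
Variable V : zmodType.
Implicit Types f g h : fps V.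

Let zero := Fps (fun _ : nat => 0 : V).
Let opp f := Fps (fun m => - coefs f m).
Let add f g := Fps (fun m => coefs f m + coefs g m).

Let addA : associative add.
Proof. by move=> f g h; apply/fpsP => m /=; rewrite addrA. Qed.
Let addC : commutative add.
Proof. by move=> f g; apply/fpsP => m /=; rewrite addrC. Qed.
Let add0 : left_id zero add.
Proof. by move=> f; apply/fpsP => m /=; rewrite add0r. Qed.
Let addN : left_inverse zero opp add.
Proof. by move=> f; apply/fpsP => m /=; rewrite addNr. Qed.

HB.instance Definition _ :=
  GRing.isZmodule.Build (fps V) addA addC add0 addN.

Definition fpsC (v : V) : fps V := Fps (fun m => if m is 0%N then v else 0).

End Zmodule.

(* Cauchy product along op *)
Definition conv (U V : Type) (W : nmodType) (op : U -> V -> W)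
    (f : fps U) (g : fps V) : fps W :=
  Fps (fun m => \sum_(i < m.+1) op (coefs f i) (coefs g (m - i)%N)).

Lemma conv_rev (U V : Type) (W : nmodType) (op : U -> V -> W) f g m :
  coefs (conv op f g) m =
  \sum_(i < m.+1) op (coefs f (m - i)%N) (coefs g i).
Proof.
rewrite /= (reindex_inj rev_ord_inj) /=.
by apply: eq_bigr => j _; rewrite (sub_ordK j).
Qed.

Lemma convA (U V X : Type) (W Z Y : nmodType) (uv : U -> V -> W)
    (wx : W -> X -> Y) (vx : V -> X -> Z) (uz : U -> Z -> Y) :
  (forall u, {morph uz u : a b / a + b}) -> (forall u, uz u 0 = 0) ->
  (forall x, {morph wx^~ x : a b / a + b}) -> (forall x, wx 0 x = 0) ->
  (forall u v x, uz u (vx v x) = wx (uv u v) x) ->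
  forall f g h, conv uz f (conv vx g h) = conv wx (conv uv f g) h.
Proof.
move=> uzD uz0 wxD wx0 opA f g h; apply/fpsP => m; rewrite [RHS]conv_rev.
pose c3 j i := uz (coefs f j) (vx (coefs g (m - j - i)%N) (coefs h i)).
transitivity (\sum_(j < m.+1) \sum_(i < m.+1 | (i <= m - j)%N) c3 j i).
  apply: eq_bigr => j _; rewrite conv_rev.
  rewrite (big_morph (uz _) (uzD _) (uz0 _)).
  by rewrite (big_ord_narrow_leq (leq_subr _ _)).
rewrite (exchange_big_dep predT) //=; apply: eq_bigr => i _.
transitivity (\sum_(j < m.+1 | (j <= m - i)%N) c3 j i).
  apply: eq_bigl => j; rewrite -ltnS -(ltnS j) -!subSn ?leq_ord //.
  by rewrite -subn_gt0 -(subn_gt0 j) -!subnDA addnC.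
rewrite (big_ord_narrow_leq (leq_subr _ _)).
rewrite (big_morph (wx^~ _) (wxD _) (wx0 _)).
by apply: eq_bigr => j _; rewrite /c3 -!subnDA addnC opA.
Qed.

Lemma convDl (U : zmodType) (V : Type) (W : zmodType) (op : U -> V -> W) :
  (forall v, {morph op^~ v : a b / a + b}) ->
  forall g, {morph (fun f => conv op f g) : a b / a + b}.
Proof.
move=> opD g a b; apply/fpsP => m /=; rewrite -big_split.
by apply: eq_bigr => i _; rewrite /= opD.
Qed.

Lemma convDr (U : Type) (V : zmodType) (W : zmodType) (op : U -> V -> W) :
  (forall u, {morph op u : a b / a + b}) ->
  forall f, {morph conv op f : a b / a + b}.
Proof.
move=> opD f a b; apply/fpsP => m /=; rewrite -big_split.
by apply: eq_bigr => i _; rewrite /= opD.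
Qed.

Lemma conv_fpsCl (U : zmodType) (V : Type) (W : nmodType) (op : U -> V -> W) :
  (forall v, op 0 v = 0) ->
  forall u g m, coefs (conv op (fpsC u) g) m = op u (coefs g m).
Proof.
by move=> op0 u g m /=; rewrite big_ord_recl /= subn0 big1 ?addr0.
Qed.

Lemma conv_fpsCr (U : Type) (V : zmodType) (W : nmodType) (op : U -> V -> W) :
  (forall u, op u 0 = 0) ->
  forall f v m, coefs (conv op f (fpsC v)) m = op (coefs f m) v.
Proof.
by move=> op0 f v m; rewrite conv_rev /= big_ord_recl /= subn0 big1 ?addr0.
Qed.

Section Ring.
Variable A : nzRingType.
Implicit Types f g h : fps A.

Let mul : fps A -> fps A -> fps A := conv *%R.

Let mulA : associative mul.
Proof.
apply: convA => *; rewrite ?mulr0 ?mul0r ?mulrA //;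
  [exact: mulrDr | by move=> ? ?; exact: mulrDl].
Qed.
Let mul1 : left_id (fpsC 1) mul.
Proof. by move=> f; apply/fpsP => m; rewrite conv_fpsCl ?mul1r //; apply: mul0r. Qed.
Let mulx1 : right_id (fpsC 1) mul.
Proof. by move=> f; apply/fpsP => m; rewrite conv_fpsCr ?mulr1 //; apply: mulr0. Qed.
Let mulDl : left_distributive mul +%R.
Proof. by move=> f g h; apply: convDl => x a b; apply: mulrDl. Qed.
Let mulDr : right_distributive mul +%R.
Proof. by move=> f g h; apply: convDr => x a b; apply: mulrDr. Qed.
Let nonzero1 : fpsC 1 != 0 :> fps A.
Proof. by apply/eqP => /fpsP /(_ 0%N) /= /eqP; rewrite oner_eq0. Qed.

HB.instance Definition _ := GRing.Zmodule_isNzRing.Build (fps A)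
  mulA mul1 mulx1 mulDl mulDr nonzero1.

End Ring.

Section ComRing.
Variable R : comNzRingType.

Let mulC : commutative (@GRing.mul (fps R)).
Proof.
move=> f g; apply/fpsP => m; rewrite [LHS]conv_rev.
by apply: eq_bigr => i _; rewrite mulrC.
Qed.

HB.instance Definition _ := GRing.PzRing_hasCommutativeMul.Build (fps R) mulC.

End ComRing.

Section Lmodule.
Variables (R : nzRingType) (V : lmodType R).

Let scale : fps R -> fps V -> fps V := conv *:%R.

Let scaleA a b v : scale a (scale b v) = scale (a * b) v.
Proof.
apply: convA => *; rewrite ?scaler0 ?scale0r ?scalerA //;
  [exact: scalerDr | exact: scalerDl].
Qed.
Let scale1 : left_id 1 scale.
Proof. by move=> f; apply/fpsP => m; rewrite conv_fpsCl ?scale1r //; apply: scale0r. Qed.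
Let scaleDr : right_distributive scale +%R.
Proof. by move=> f g h; apply: convDr => x a b; apply: scalerDr. Qed.
Let scaleDl v : {morph scale^~ v : a b / a + b}.
Proof. by apply: convDl => x a b; apply: scalerDl. Qed.

HB.instance Definition _ := GRing.Zmodule_isLmodule.Build (fps R) (fps V)
  scaleA scale1 scaleDr scaleDl.

End Lmodule.

Section Algebra.
Variables (R : comNzRingType) (A : algType R).

Let scaleAl (c : fps R) (f g : fps A) : c *: (f * g) = c *: f * g.
Proof.
apply: convA => *; rewrite ?scaler0 ?mul0r ?scalerAl //;
  [exact: scalerDr | by move=> ? ?; exact: mulrDl].
Qed.

HB.instance Definition _ :=
  GRing.Lmodule_isLalgebra.Build (fps R) (fps A) scaleAl.

Let scaleAr (c : fps R) (f g : fps A) : c *: (f * g) = f * (c *: g).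
Proof.
transitivity (conv (fun a c => c *: a) f c * g); last first.
  apply: esym; apply: convA => *; rewrite ?mulr0 ?mul0r //;
    [exact: mulrDr | by move=> ? ?; exact: mulrDl | by rewrite -scalerAr scalerAl].
rewrite scaleAl; congr (_ * g); apply/fpsP => m.
by rewrite conv_rev.
Qed.

HB.instance Definition _ :=
  GRing.Lalgebra_isAlgebra.Build (fps R) (fps A) scaleAr.

End Algebra.

Section Deformation.
Variables (C : comNzRingType) (A : algType C).
Implicit Types star : fps A -> fps A -> fps A.

Definition is_identity star (e : fps A) := left_id e star /\ right_id e star.

(* Algebras are unital, but the unit of star need not be the constant 1.      *)
Record deformation star : Prop := Deformation {
  deformation_bilinear :
    bilinear_for (R := fps C) *:%R *:%R star;
  deformation_assoc : associative star;
  deformation_unital : exists e, is_identity star e;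
  deformation_form : exists Omega : nat -> A -> A -> A,
    (forall m, (1 <= m)%N -> bilinear_for (R := C) *:%R *:%R (Omega m)) /\
    (forall a b, star (fpsC a) (fpsC b) =
       Fps (fun m => if m is 0%N then a * b else Omega m a b))
}.

Definition equivalent star1 star2 :=
  exists phi : {linear fps A -> fps A},
    [/\ bijective phi,
        {morph phi : f g / star1 f g >-> star2 f g},
        forall e, is_identity star1 e -> is_identity star2 (phi e) &
        forall f, coefs (phi f) 0%N = coefs f 0%N].

Lemma undeformed : deformation (@GRing.mul (fps A)).
Proof.
split.
- split=> f a g h /=; first by rewrite mulrDl scalerAl.
  by rewrite mulrDr scalerAr.
- exact: mulrA.
- by exists 1; split; [exact: mul1r | exact: mulr1].
- exists (fun _ _ _ => 0); split=> [m _|a b].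
    by split=> f c g h /=; rewrite scaler0 addr0.
  apply/fpsP => m; rewrite [LHS]conv_fpsCl; last exact: mul0r.
  by case: m => //= m; rewrite mulr0.
Qed.

(* The multiplication of the ring fps A is the C[[Lambda]]-bilinear extension *)
(* of the multiplication of A.                                                *)
Definition rigid := forall star, deformation star -> equivalent star *%R.

End Deformation.

Section Quotient.
Variables (C : comNzRingType) (A : algType C) (S : A -> Prop).

Inductive ideal_gen : A -> Prop :=
| ideal_gen0 : ideal_gen 0
| ideal_genD x y : ideal_gen x -> ideal_gen y -> ideal_gen (x + y)
| ideal_genM a s b : S s -> ideal_gen (a * s * b).

Lemma ideal_gen_mul a x b : ideal_gen x -> ideal_gen (a * x * b).
Proof.
elim=> [|y z _ IHy _ IHz|c s d Ss]; first by rewrite mulr0 mul0r; constructor.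
- by rewrite mulrDr mulrDl; constructor.
- by rewrite -!mulrA mulrA (mulrA _ s); constructor.
Qed.

Lemma ideal_gen_mull a x : ideal_gen x -> ideal_gen (a * x).
Proof. by move/(ideal_gen_mul a 1); rewrite mulr1. Qed.

Lemma ideal_gen_mulr b x : ideal_gen x -> ideal_gen (x * b).
Proof. by move/(ideal_gen_mul 1 b); rewrite mul1r. Qed.

Definition ideal_pred : {pred A} := fun x => `[< ideal_gen x >].

Lemma ideal_predP x : reflect (ideal_gen x) (x \in ideal_pred).
Proof. exact: asboolP. Qed.

Let ideal_zmod : zmod_closed ideal_pred.
Proof.
split=> [|x y /ideal_predP Ix /ideal_predP Iy]; apply/ideal_predP.
  exact: ideal_gen0.
by apply: ideal_genD => //; rewrite -mulN1r; apply: ideal_gen_mull.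
Qed.

HB.instance Definition _ := GRing.isZmodClosed.Build A ideal_pred ideal_zmod.

(* A modulo the two-sided ideal generated by S *)
Definition quot_alg := Quotient.quot ideal_pred.

End Quotient.

Section QuotientTheory.
Variables (C : comNzRingType) (A : algType C) (S : A -> Prop).
Local Notation Q := (quot_alg S).

HB.instance Definition _ := GRing.Zmodule.on Q.

Definition quot_pi (x : A) : Q := (\pi_(Quotient.quot (ideal_pred S)) x)%qT.
Local Notation pi := quot_pi.

Lemma quot_piP x y : pi x = pi y <-> ideal_gen S (x - y).
Proof.
split=> [/eqP|Ixy]; last apply/eqP.
  by rewrite -Quotient.idealrBE => /ideal_predP.
by rewrite -Quotient.idealrBE; apply/ideal_predP.
Qed.

Let rep (y : Q) : A := (repr (y : Quotient.quot (ideal_pred S)))%qT.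
Let repK y : pi (rep y) = y. Proof. exact: reprK. Qed.

Lemma quot_piD : {morph pi : x y / x + y}.
Proof. by move=> x y; rewrite /pi !piE. Qed.

Lemma quot_pi0 : pi 0 = 0.
Proof. by rewrite /pi piE. Qed.

Let ideal_rep x : ideal_gen S (rep (pi x) - x).
Proof. by apply/quot_piP; rewrite repK. Qed.

Let mul (x y : Q) : Q := pi (rep x * rep y).
Let piM x y : mul (pi x) (pi y) = pi (x * y).
Proof.
apply/quot_piP; rewrite -(subrK (x * rep (pi y)) (_ * _)) -mulrBl -addrA -mulrBr.
by apply: ideal_genD; [apply: ideal_gen_mulr | apply: ideal_gen_mull].
Qed.

Let mulA : associative mul.
Proof. by move=> x y z; rewrite -[x]repK -[y]repK -[z]repK !piM mulrA. Qed.
Let mul1 : left_id (pi 1) mul.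
Proof. by move=> x; rewrite -[x]repK piM mul1r. Qed.
Let mulx1 : right_id (pi 1) mul.
Proof. by move=> x; rewrite -[x]repK piM mulr1. Qed.
Let mulDl : left_distributive mul +%R.
Proof.
move=> x y z; rewrite -[x]repK -[y]repK -[z]repK.
by rewrite -quot_piD !piM mulrDl quot_piD.
Qed.
Let mulDr : right_distributive mul +%R.
Proof.
move=> x y z; rewrite -[x]repK -[y]repK -[z]repK.
by rewrite -quot_piD !piM mulrDr quot_piD.
Qed.

HB.instance Definition _ :=
  GRing.Zmodule_isPzRing.Build Q mulA mul1 mulx1 mulDl mulDr.

Lemma quot_pi1 : pi 1 = 1. Proof. by []. Qed.
Lemma quot_piM : {morph pi : x y / x * y}.
Proof. by move=> x y; rewrite -piM. Qed.

Let scale (c : C) (x : Q) : Q := pi (c *: rep x).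
Let piZ c x : scale c (pi x) = pi (c *: x).
Proof.
apply/quot_piP; rewrite -scalerBr -[_ - _]mul1r scalerAl.
exact/ideal_gen_mull/ideal_rep.
Qed.

Let scaleA a b x : scale a (scale b x) = scale (a * b) x.
Proof. by rewrite -[x]repK !piZ scalerA. Qed.
Let scale1 : left_id 1 scale.
Proof. by move=> x; rewrite -[x]repK piZ scale1r. Qed.
Let scaleDr : right_distributive scale +%R.
Proof.
move=> c x y; rewrite -[x]repK -[y]repK.
by rewrite -quot_piD !piZ scalerDr quot_piD.
Qed.
Let scaleDl x : {morph scale^~ x : a b / a + b}.
Proof. by move=> a b; rewrite -[x]repK !piZ scalerDl quot_piD. Qed.

HB.instance Definition _ :=
  GRing.Zmodule_isLmodule.Build C Q scaleA scale1 scaleDr scaleDl.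

Lemma quot_piZ c : {morph pi : x / c *: x}.
Proof. by move=> x; rewrite -piZ. Qed.

Lemma quot_pi_surj y : exists x, y = pi x.
Proof. by exists (rep y); rewrite repK. Qed.

Lemma quot_scaleAl (c : C) (x y : Q) : c *: (x * y) = c *: x * y.
Proof.
rewrite -[x]repK -[y]repK.
by rewrite -quot_piM -!quot_piZ -quot_piM scalerAl.
Qed.

Lemma quot_scaleAr (c : C) (x y : Q) : c *: (x * y) = x * (c *: y).
Proof.
rewrite -[x]repK -[y]repK.
by rewrite -quot_piM -!quot_piZ -quot_piM scalerAr.
Qed.

End QuotientTheory.

(* The free associative unital algebra on the set G *)
Definition free_alg (C : comNzRingType) (G : choiceType) := {malg C[{fmonom G}]}.

Section FreeAlgebra.
Variables (C : comNzRingType) (G : choiceType).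

HB.instance Definition _ := GRing.Lalgebra.on (free_alg C G).

Let scaleAr (c : C) (x y : free_alg C G) : c *: (x * y) = x * (c *: y).
Proof.
rewrite -!mul_malgC !mulrA; congr (_ * y).
rewrite [LHS]fgmulUg [RHS]fgmulgU; apply: eq_bigr => m _.
by rewrite mulrC mulm1 mul1m.
Qed.

HB.instance Definition _ :=
  GRing.Lalgebra_isAlgebra.Build C (free_alg C G) scaleAr.

Definition free_gen (x : G) : free_alg C G := << fmu x >>.

End FreeAlgebra.

Variant cw_index (n k : nat) : Type :=
  | OmegaIndex of 'I_n | PIndex of 'I_k | QIndex of 'I_k.

Section CliffordWeylIndex.
Variables n k : nat.

Let to_sum (g : cw_index n k) : 'I_n + ('I_k + 'I_k) :=
  match g with
  | OmegaIndex i => inl i | PIndex j => inr (inl j) | QIndex j => inr (inr j)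
  end.
Let of_sum (g : 'I_n + ('I_k + 'I_k)) : cw_index n k :=
  match g with
  | inl i => OmegaIndex k i | inr (inl j) => PIndex n j | inr (inr j) => QIndex n j
  end.
Let to_sumK : cancel to_sum of_sum. Proof. by case. Qed.

HB.instance Definition _ := Equality.copy (cw_index n k) (can_type to_sumK).
HB.instance Definition _ := Choice.copy (cw_index n k) (can_type to_sumK).

End CliffordWeylIndex.

Section CliffordWeylRelations.
Variables (C : comNzRingType) (n k : nat).

Local Notation F := (free_alg C (cw_index n k)).

Definition cw_omega (i : 'I_n) : F := free_gen C (OmegaIndex k i).
Definition cw_p (i : 'I_k) : F := free_gen C (PIndex n i).
Definition cw_q (i : 'I_k) : F := free_gen C (QIndex n i).

Local Notation w := cw_omega.
Local Notation p := cw_p.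
Local Notation q := cw_q.

(* [cw_rel r]: the relation r = 0 is one of the defining relations *)
Inductive cw_rel : F -> Prop :=
| cw_rel_ww i j : cw_rel (w i * w j + w j * w i - (2 * (i == j))%:R)
| cw_rel_pq i j : cw_rel (p i * q j - q j * p i - (i == j)%:R)
| cw_rel_pp i j : cw_rel (p i * p j - p j * p i)
| cw_rel_qq i j : cw_rel (q i * q j - q j * q i)
| cw_rel_wp i j : cw_rel (w i * p j + p j * w i)
| cw_rel_wq i j : cw_rel (w i * q j + q j * w i).

End CliffordWeylRelations.

Section NonTrivial.
Variables (C : comNzRingType) (n k : nat).
Local Notation I := (cw_index n k).
Local Notation F := (free_alg C I).
Local Notation cw_rel := (@cw_rel C n k).

(* The generators act on functions of a state (b, m) by a Fock-type           *)
(* representation satisfying the relations; hence 1 is not in the ideal.      *)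
Let state := ({ffun 'I_n -> bool} * {ffun 'I_k -> nat})%type.

Let par (u : nat) (b : {ffun 'I_n -> bool}) : bool :=
  \big[addb/false]_(j < n | (j < u)%N) b j.
Let flip (i : 'I_n) (b : {ffun 'I_n -> bool}) : {ffun 'I_n -> bool} :=
  [ffun j => b j (+) (j == i)].
Let incr (i : 'I_k) (m : {ffun 'I_k -> nat}) : {ffun 'I_k -> nat} :=
  [ffun j => m j + (j == i)]%N.
Let decr (i : 'I_k) (m : {ffun 'I_k -> nat}) : {ffun 'I_k -> nat} :=
  [ffun j => m j - (j == i)]%N.

Let coef (g : I) (s : state) : C :=
  match g with
  | OmegaIndex i => (-1) ^+ par i s.1
  | PIndex _ => (-1) ^+ par n s.1
  | QIndex i => (-1) ^+ par n s.1 * (s.2 i)%:R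
  end.
Let move (g : I) (s : state) : state :=
  match g with
  | OmegaIndex i => (flip i s.1, s.2)
  | PIndex i => (s.1, incr i s.2)
  | QIndex i => (s.1, decr i s.2)
  end.

Let act (gs : seq I) (f : state -> C) : state -> C :=
  foldr (fun g f s => coef g s * f (move g s)) f gs.

Let ev (f : state -> C) (s : state) (x : F) : C :=
  mmap (idfun : C -> C) (fun m : {fmonom I} => act m f s) x.

Let act_sum gs (J : Type) (r : seq J) (c : J -> C) (f : J -> state -> C) s :
  act gs (fun t => \sum_(i <- r) c i * f i t) s =
  \sum_(i <- r) c i * act gs (f i) s.
Proof.
elim: gs s => [//|g gs IH] s /=; rewrite IH mulr_sumr.
by apply: eq_bigr => i _; rewrite mulrCA.
Qed.

Let evD f s : {morph ev f s : x y / x + y}.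
Proof. exact: mmapD. Qed.
Let evN f s : {morph ev f s : x / - x}.
Proof. exact: mmapN. Qed.
Let ev0 f s : ev f s 0 = 0.
Proof. exact: mmap0. Qed.

Let evM f s x y : ev f s (x * y) = ev (fun t => ev f t y) s x.
Proof.
rewrite [x * y]malgME (big_morph _ (evD f s) (ev0 f s)).
rewrite [RHS]/ev [RHS]/mmap; apply: eq_bigr => a _.
rewrite act_sum mulr_sumr (big_morph _ (evD f s) (ev0 f s)).
apply: eq_bigr => b _; rewrite /ev mmapU /= -mulrA; congr (_ * (_ * _)).
by rewrite fmM /act foldr_cat.
Qed.

Let ev1 f s : ev f s 1 = f s.
Proof. by rewrite /ev mmapU /= mul1r fm1. Qed.

Let ev_nat f s m : ev f s m%:R = m%:R * f s.
Proof.
elim: m => [|m IH]; first by rewrite ev0 mul0r.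
by rewrite -addn1 !natrD evD IH ev1 mulrDl mul1r.
Qed.

Let ev_gen f s g : ev f s (free_gen C g) = coef g s * f (move g s).
Proof. by rewrite /ev mmapU /= mul1r fmU. Qed.

Let par_flip u i b : par u (flip i b) = par u b (+) (i < u)%N.
Proof.
rewrite /par (eq_bigr (fun j => b j (+) (j == i))); last first.
  by move=> j _; rewrite ffunE.
rewrite big_split /=; congr (_ (+) _).
have [lt_iu|le_ui] := ltnP i u.
  by rewrite (bigD1 i) //= eqxx big1 // => j /andP[_ /negbTE].
by apply: big1 => j lt_ju; apply/eqP => ji; rewrite ji ltnNge le_ui in lt_ju.
Qed.

Let flipC i j b : flip i (flip j b) = flip j (flip i b).
Proof. by apply/ffunP => l; rewrite !ffunE addbAC. Qed.
Let flipK i b : flip i (flip i b) = b.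
Proof. by apply/ffunP => l; rewrite !ffunE addbK. Qed.

Let incrC i j m : incr i (incr j m) = incr j (incr i m).
Proof. by apply/ffunP => l; rewrite !ffunE addnAC. Qed.
Let decrC i j m : decr i (decr j m) = decr j (decr i m).
Proof. by apply/ffunP => l; rewrite !ffunE subnAC. Qed.

Let sgnK (b : bool) : (-1) ^+ b * (-1) ^+ b = 1 :> C.
Proof. by rewrite -signr_addb addbb. Qed.

Let sgnM (b : bool) (x : C) : (-1) ^+ b * ((-1) ^+ b * x) = x.
Proof. by rewrite mulrA sgnK mul1r. Qed.
Let sgnM2 (b : bool) (x y : C) : (-1) ^+ b * (x * ((-1) ^+ b * y)) = x * y.
Proof. by rewrite mulrCA sgnM. Qed.

Let incrK i m : decr i (incr i m) = m.
Proof. by apply/ffunP => l; rewrite !ffunE addnK. Qed.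
Let decrK i (m : {ffun 'I_k -> nat}) : (0 < m i)%N -> incr i (decr i m) = m.
Proof.
move=> mi; apply/ffunP => l; rewrite !ffunE subnK //.
by case: eqP => [->|].
Qed.
Let incr_decr i j m : i != j -> decr j (incr i m) = incr i (decr j m).
Proof.
move=> ne_ij; apply/ffunP => l; rewrite !ffunE.
have [->|_] := eqVneq l i; first by rewrite (negbTE ne_ij) !subn0.
by rewrite !addn0.
Qed.

Let evB f s x y : ev f s (x - y) = ev f s x - ev f s y.
Proof. exact: mmapB. Qed.

Let ev_gg f s g h : ev f s (free_gen C g * free_gen C h) =
  coef g s * (coef h (move g s) * f (move h (move g s))).
Proof. by rewrite evM ev_gen ev_gen. Qed.

Let ev_anti f s g h :
  ev f s (free_gen C g * free_gen C h + free_gen C h * free_gen C g) =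
  coef g s * (coef h (move g s) * f (move h (move g s))) +
  coef h s * (coef g (move h s) * f (move g (move h s))).
Proof. by rewrite evD [X in X + _]ev_gg [X in _ + X]ev_gg. Qed.

Let ev_comm f s g h :
  ev f s (free_gen C g * free_gen C h - free_gen C h * free_gen C g) =
  coef g s * (coef h (move g s) * f (move h (move g s))) -
  coef h s * (coef g (move h s) * f (move g (move h s))).
Proof. by rewrite evB [X in X - _]ev_gg [X in _ - X]ev_gg. Qed.

Let ev_rel f s r : cw_rel r -> ev f s r = 0.
Proof.
case: s => b m; case=> i j.
- rewrite evB [X in X - _]ev_anti [X in _ - X]ev_nat /=.
  have [<-|ne_ij] := eqVneq i j.
    by rewrite par_flip ltnn addbF flipK mulrA sgnK mul1r mulrDl mul1r subrr.
  rewrite !mulrA -!signr_addb !par_flip (flipC j i) mul0r subr0 -mulrDl.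
  have: (i < j)%N (+) (j < i)%N by move: ne_ij; rewrite -val_eqE; case: ltngtP.
  case: (i < j)%N (j < i)%N => [] [] // _; case: (par i b) (par j b) => [] [];
    by rewrite /= ?expr0 ?expr1 ?addrN ?addNr mul0r.
- rewrite evB [X in X - _]ev_comm [X in _ - X]ev_nat /=.
  rewrite -!mulrA sgnM sgnM2 ffunE; have [<-|ne_ij] := eqVneq i j.
    rewrite incrK natrD mul1r mulrDl mul1r; case mi: (m i) => [|u].
      by rewrite !mul0r subr0 add0r subrr.
    by rewrite decrK ?mi // -addrA -opprD subrr.
  by rewrite addn0 mul0r subr0 incr_decr // subrr.
- by rewrite ev_comm /= incrC subrr.
- rewrite ev_comm /= -!mulrA sgnM2 sgnM2 !ffunE decrC !mulrA -!natrM -mulrBl.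
  have [->|ne_ij] := eqVneq i j; first by rewrite subrr mul0r.
  by rewrite !subn0 mulnC subrr mul0r.
- rewrite ev_anti /= par_flip ltn_ord addbT.
  by rewrite signrN mulNr mulrN mulrCA addNr.
- rewrite ev_anti /= par_flip ltn_ord addbT signrN !mulNr mulrN.
  by rewrite mulrCA -!mulrA addNr.
Qed.

Let ev_ideal x : ideal_gen cw_rel x -> forall f s, ev f s x = 0.
Proof.
elim=> [|y z _ IHy _ IHz|a r c rel_r] f s; first exact: ev0.
  by rewrite evD IHy IHz addr0.
rewrite !evM -(ev0 f s) -[in RHS](mulr0 a) evM; congr (mmap _ _ a).
by apply/funext => gs; congr act; apply/funext => t; rewrite ev_rel ?ev0.
Qed.

Lemma cw_rel_proper : ~ ideal_gen cw_rel 1.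
Proof.
move=> /ev_ideal /(_ (fun _ => 1) ([ffun=> false], [ffun=> 0%N])).
by rewrite ev1 => /eqP; rewrite oner_eq0.
Qed.

End NonTrivial.

Section CliffordWeyl.
Variables (C : comNzRingType) (n k : nat).

(* [clifford_weyl C n k] is the algebra C(n, 2k) over the ground ring C *)
Definition clifford_weyl := quot_alg (@cw_rel C n k).

HB.instance Definition _ := GRing.PzRing.on clifford_weyl.
HB.instance Definition _ := GRing.Lmodule.on clifford_weyl.

Let cw_neq0 : 1 != 0 :> clifford_weyl.
Proof.
apply/eqP => pi10; apply: (@cw_rel_proper C n k); rewrite -[1]subr0.
by apply/quot_piP; rewrite quot_pi0 -pi10.
Qed.

HB.instance Definition _ :=
  GRing.PzSemiRing_isNonZero.Build clifford_weyl cw_neq0.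
HB.instance Definition _ :=
  GRing.Lmodule_isLalgebra.Build C clifford_weyl (@quot_scaleAl _ _ (@cw_rel C n k)).
HB.instance Definition _ :=
  GRing.Lalgebra_isAlgebra.Build C clifford_weyl (@quot_scaleAr _ _ (@cw_rel C n k)).

End CliffordWeyl.

(* Main.v *)
(* A deformation B of A = C(n, 2k) is trivial as soon as the generators of A
   lift to B in such a way that the defining relations still hold: these lifts
   define a morphism s : A -> B that is a section of B -> A, and then
   sum_m Lambda^m f_m |-> sum_m Lambda^m s(f_m) is an isomorphism A[[Lambda]] -> B.

   The omegas are lifted one at a time: averaging under conjugation by the
   previous ones makes a lift anticommute with them, and the Newton iteration
   g |-> g (3 - g^2) / 2 then turns it into an involution. The p's and q's,
   written x_a, are also made to anticommute with the omegas by averaging, and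
   their commutators are corrected one power of Lambda at a time. The error
   c_ab is a 2-cocycle of the Koszul complex of the commuting operators
   D_a = [x_a, -] on A, and the correction exists if it is a coboundary.

   The symmetrised multiplications X_b by the dual basis satisfy
   [D_a, X_b] = delta_ab, and A is the direct sum of the part A0 where the D_a
   are locally nilpotent and the part A1 where the X_a are: multiplication by
   an omega exchanges A0 and A1. On A0 the complex is the polynomial de Rham
   complex, which is exact in degree 2. On A1 it is the Koszul complex of 2k
   independent multiplications, whose cohomology is in degree 2k only; for
   k = 1 this is degree 2, and for k = 0 there is nothing to correct. *)

From Stdlib Require Import Ncring Ncring_tac.
From HB Require Import structures.
Require Import Defs.
From mathcomp Require Import all_boot all_algebra.
From mathcomp Require Import finmap monalg.
From mathcomp Require Import boolp reals complex.

Set Implicit Arguments.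
Unset Strict Implicit.
Unset Printing Implicit Defensive.

Import GRing.Theory Num.Theory.
Local Open Scope ring_scope.

(** * Iterates of linear operators *)

Section Iterates.
Variables (F : pzRingType) (V : lmodType F).
Implicit Types P T : {linear V -> V}.

Lemma iter_linearD P n : {morph iter n P : x y / x + y}.
Proof. by move=> x y; elim: n => //= n ->; rewrite linearD. Qed.

Lemma iter_linear0 P n : iter n P 0 = 0.
Proof. by elim: n => //= n ->; rewrite linear0. Qed.

Lemma iter_linearZ P n c : {morph iter n P : x / c *: x}.
Proof. by move=> x; elim: n => //= n ->; rewrite linearZ. Qed.

Lemma iter_linearN P n : {morph iter n P : x / - x}.
Proof. by move=> x; elim: n => //= n ->; rewrite linearN. Qed.

Lemma iter_linearMn P n m : {morph iter n P : x / x *+ m}.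
Proof. by move=> x; elim: n => //= n ->; rewrite linearMn. Qed.

Lemma iter_eq0_leq P m n f : (m <= n)%N -> iter m P f = 0 -> iter n P f = 0.
Proof. by move=> /subnK <- f0; rewrite iterD f0 iter_linear0. Qed.

Lemma iter_comm P T n f :
  (forall g, T (P g) = P (T g)) -> T (iter n P f) = iter n P (T f).
Proof. by move=> PT; elim: n => //= n <-. Qed.

Lemma iter_scalar_comm P T c :
    (forall f, P (T f) = T (P f) + c *: f) ->
  forall n f, iter n P (T f) = T (iter n P f) + c *: iter n.-1 P f *+ n.
Proof.
move=> PT; elim=> [|n IH] f; first by rewrite mulr0n addr0.
rewrite iterS IH linearD PT -addrA; congr (_ + _).
rewrite mulrSr addrC linearMn linearZ; congr (_ + _).
by case: n {IH} => [|n]; rewrite ?mulr0n.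
Qed.

End Iterates.

(** * Pairs of operators with [P, Q] = 1 *)

Section HeisenbergPair.
Variables (F : numFieldType) (V : lmodType F) (P Q : {linear V -> V}).
Hypothesis PQ : forall f, P (Q f) = Q (P f) + f.
Implicit Types (f : V) (N : nat).

Let iterPQ n f : iter n P (Q f) = Q (iter n P f) + iter n.-1 P f *+ n.
Proof.
by rewrite (@iter_scalar_comm _ _ P Q 1) ?scale1r // => g; rewrite scale1r.
Qed.

Let PiterQ n f : P (iter n Q f) = iter n Q (P f) + iter n.-1 Q f *+ n.
Proof.
rewrite (@iter_scalar_comm _ _ Q P (- 1)) => [|g]; last by rewrite PQ scaleN1r addrK.
by rewrite scaleN1r mulNrn subrK.
Qed.

Lemma natmul_eq0 n f : f *+ n.+1 = 0 -> f = 0.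
Proof.
move=> /eqP; rewrite -scaler_nat scaler_eq0 pnatr_eq0 /= => /eqP //.
Qed.

(** Since [P^(N+1), Q] = (N+1) P^N, a vector of ker Q killed by P^(N+1) is already killed by P^N. *)
Lemma heisenberg_inj N f : iter N P f = 0 -> Q f = 0 -> f = 0.
Proof.
elim: N => // N IH fN Qf; apply: IH => //.
have := iterPQ N.+1 f; rewrite Qf iter_linear0 fN linear0 add0r => /esym.
exact: natmul_eq0.
Qed.

(** Induction on N: Q f is killed by P^(M+1) and by one power of Q less, hence is zero, and Q is
    injective on P-nilpotent vectors. *)
Lemma heisenberg_nilp M N f : iter M P f = 0 -> iter N Q f = 0 -> f = 0.
Proof.
elim: N M f => // N IH M f fM fN; apply: (heisenberg_inj fM).
apply: (IH M.+1); last by rewrite -iterSr.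
by rewrite iterPQ /= fM !linear0 add0r mul0rn.
Qed.

(** The recurrence (j+1) c_(j+1) = -c_j makes the sums below telescope. *)
Definition taylor_coef j : F := (-1) ^+ j / j`!%:R.
Local Notation c := taylor_coef.

Let c0 : c 0 = 1. Proof. by rewrite /c expr0 fact0 divr1. Qed.

Let cS j : c j.+1 *+ j.+1 = - c j.
Proof.
rewrite /c factS natrM invfM exprS mulN1r mulNr mulNrn; congr (- _).
by rewrite mulrCA -[LHS]mulr_natl mulVKf ?pnatr_eq0.
Qed.

(* With P the derivative with respect to Q, this is the primitive vanishing *)
(* at the origin, as given by repeated integration by parts.                *)
Definition heis_int N f : V :=
  \sum_(0 <= j < N) - c j.+1 *: iter j.+1 Q (iter j P f).

Lemma heis_intK N f : iter N P f = 0 -> P (heis_int N f) = f.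
Proof.
(* P maps the j-th summand to u (j+1) - u j, where u N = 0 and u 0 = -f. *)
move=> fN; pose u j := - c j *: iter j Q (iter j P f).
rewrite linear_sum /= (telescope_sumr_eq u) // => [|j _].
  by rewrite /u fN iter_linear0 scaler0 sub0r scaleNr opprK c0 scale1r.
rewrite linearZ (PiterQ j.+1) [LHS]/= scalerDr; congr (_ + _).
by rewrite -scalerMnr scalerMnl mulNrn cS opprK /u scaleNr opprK.
Qed.

(* With -Q a variable and P the derivative with respect to it, these are the *)
(* value at the origin and the quotient by Q of the remainder.               *)
Definition heis_const N f : V :=
  \sum_(0 <= j < N.+1) c j *: iter j Q (iter j P f).

Definition heis_div N f : V :=
  \sum_(0 <= j < N) - c j.+1 *: iter j Q (iter j.+1 P f).

Lemma heis_divE N f : f = Q (heis_div N f) + heis_const N f.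
Proof.
rewrite /heis_const big_nat_recl //= c0 scale1r addrCA linear_sum /= -big_split.
rewrite big1 ?addr0 // => j _.
by rewrite linearZ /= scaleNr addNr.
Qed.

Lemma heis_constQ N f : iter N P f = 0 -> heis_const N (Q f) = 0.
Proof.
(* The sum has N + 1 terms, so it telescopes to u (N+1), which contains P^N f. *)
move=> fN; pose u j := if j is i.+1 then c i *: iter j Q (iter i P f) else 0.
rewrite /heis_const (telescope_sumr_eq u) // => [|j _].
  by rewrite /u fN iter_linear0 scaler0 subr0.
rewrite iterPQ iter_linearD scalerDr /u -iterSr; congr (_ + _).
case: j => [|j]; first by rewrite mulr0n scaler0 oppr0.
by rewrite iter_linearMn -scalerMnr scalerMnl cS scaleNr.
Qed.

End HeisenbergPair.

(** * Vectors nilpotent under a family of operators *)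

Section LocallyNilpotent.
Variables (F : pzRingType) (V : lmodType F) (T : Type) (P : T -> {linear V -> V}).
Implicit Types f g : V.

Definition loc_nilp f := exists N, forall a, iter N (P a) f = 0.

Lemma loc_nilp0 : loc_nilp 0.
Proof. by exists 0%N. Qed.

Lemma loc_nilpD f g : loc_nilp f -> loc_nilp g -> loc_nilp (f + g).
Proof.
move=> [M fM] [N gN]; exists (maxn M N) => a; rewrite iter_linearD.
by rewrite (iter_eq0_leq (leq_maxl _ _) (fM a)) (iter_eq0_leq (leq_maxr _ _) (gN a)) addr0.
Qed.

Lemma loc_nilpZ c f : loc_nilp f -> loc_nilp (c *: f).
Proof. by move=> [N fN]; exists N => a; rewrite iter_linearZ fN scaler0. Qed.

Lemma loc_nilpB f g : loc_nilp f -> loc_nilp g -> loc_nilp (f - g).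
Proof. by move=> fn gn; rewrite -scaleN1r; apply/loc_nilpD/loc_nilpZ. Qed.

Lemma loc_nilp_sum (I : Type) (r : seq I) (u : I -> V) :
  (forall i, loc_nilp (u i)) -> loc_nilp (\sum_(i <- r) u i).
Proof.
by move=> un; elim/big_rec: _ => [|i x _ xn]; [exact: loc_nilp0 | exact: loc_nilpD].
Qed.

(** An operator whose commutators with the [P a] are scalar raises the nilpotency exponent by at
    most one. *)
Lemma loc_nilp_op (Q : {linear V -> V}) (c : T -> F) :
    (forall a f, P a (Q f) = Q (P a f) + c a *: f) ->
  forall f, loc_nilp f -> loc_nilp (Q f).
Proof.
move=> PQ f [N fN]; exists N.+1 => a.
by rewrite (iter_scalar_comm (PQ a)) /= fN !linear0 scaler0 mul0rn addr0.
Qed.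

Lemma loc_nilp_iter (Q : V -> V) n f :
  (forall g, loc_nilp g -> loc_nilp (Q g)) -> loc_nilp f -> loc_nilp (iter n Q f).
Proof. by move=> nQ nf; elim: n => //= n; apply: nQ. Qed.

Lemma loc_nilp_uniform (I : finType) (u : I -> V) :
  (forall i, loc_nilp (u i)) -> exists N, forall i a, iter N (P a) (u i) = 0.
Proof.
move=> /fin_all_exists [N uN]; exists (\max_i N i) => i a.
by apply: iter_eq0_leq (uN i a); apply: leq_bigmax.
Qed.

End LocallyNilpotent.

(** * Koszul cochains of degrees 1 and 2 *)

Section Koszul.
Variables (F : pzRingType) (V : lmodType F) (T : Type) (D : T -> {linear V -> V}).
Implicit Types (y : T -> V) (c : T -> T -> V).

Definition koszul_d y a b := D a (y b) - D b (y a).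

(** A 2-cochain is any function of two indices, so antisymmetry is imposed along with closedness. *)
Definition koszul_cocycle c :=
  (forall a b, c a b = - c b a) /\
  (forall a b e, D a (c b e) + D b (c e a) + D e (c a b) = 0).

Lemma koszul_dD y z a b :
  koszul_d (fun a => y a + z a) a b = koszul_d y a b + koszul_d z a b.
Proof. by rewrite /koszul_d !linearD addrACA. Qed.

Lemma koszul_cocycleE c a b e :
  koszul_cocycle c -> D a (c b e) = D b (c a e) - D e (c a b).
Proof.
move=> [ca cd]; have /eqP := cd a b e.
by rewrite (ca e a) linearN -addrA addr_eq0 opprD opprK => /eqP.
Qed.

Hypothesis DD : forall a b f, D a (D b f) = D b (D a f).

Lemma koszul_dd y : koszul_cocycle (koszul_d y).
Proof.
split=> [a b|a b e]; first by rewrite opprB.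
rewrite /koszul_d !linearB /= (DD b a) (DD e a) (DD e b).
move: (D a (D b _)) (D a (D e _)) (D b (D e _)) => x y' z.
by rewrite (addrC (x - y')) (addrA (z - x)) subrK addrA subrK subrr.
Qed.

Lemma koszul_cocycleB c c' :
  koszul_cocycle c -> koszul_cocycle c' ->
  koszul_cocycle (fun a b => c a b - c' a b).
Proof.
move=> [ca cd] [ca' cd']; split=> [a b|a b e]; first by rewrite ca ca' opprB addrC opprK.
by rewrite !linearB /= [X in X + _]addrACA -opprD addrACA -opprD cd cd' subrr.
Qed.

End Koszul.

(** * The polynomial de Rham complex in degree 2 *)

Section Poincare.
Variables (F : numFieldType) (V : lmodType F) (T : finType).
Variables D X : T -> {linear V -> V}.
Hypothesis DD : forall a b f, D a (D b f) = D b (D a f).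
Hypothesis DX : forall a b f, D a (X b f) = X b (D a f) + (a == b)%:R *: f.

Let DXa a f : D a (X a f) = X a (D a f) + f.
Proof. by rewrite DX eqxx scale1r. Qed.

Let DXne a b f : a != b -> D a (X b f) = X b (D a f).
Proof. by move=> /negbTE ab; rewrite DX ab scale0r addr0. Qed.

Let nilpD a f : loc_nilp D f -> loc_nilp D (D a f).
Proof.
by apply: (@loc_nilp_op _ _ _ _ _ (fun=> 0)) => b g; rewrite DD scale0r addr0.
Qed.

Let nilpX a f : loc_nilp D f -> loc_nilp D (X a f).
Proof. by apply: (@loc_nilp_op _ _ _ _ _ (fun b => (b == a)%:R)) => b g; rewrite DX. Qed.

Let nilp_int a N f : loc_nilp D f -> loc_nilp D (heis_int (D a) (X a) N f).
Proof.
move=> fn; apply: loc_nilp_sum => j; apply/loc_nilpZ/loc_nilp_iter; first exact: nilpX.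
by apply: loc_nilp_iter fn; apply: nilpD.
Qed.

Let int_comm a b N f :
  a != b -> D b (heis_int (D a) (X a) N f) = heis_int (D a) (X a) N (D b f).
Proof.
move=> ab; rewrite linear_sum; apply: eq_bigr => j _.
rewrite linearZ; congr (_ *: _).
rewrite iter_comm => [|g]; last by rewrite DXne // eq_sym.
by rewrite (iter_comm j f (T := D b)) // => g; rewrite DD.
Qed.

(** The rows of c are made exact one index at a time, by integrating the remaining error in the
    direction of the new index. Local nilpotency of y is carried along so that the error can be
    integrated at the next step. *)
Lemma poincare c :
    koszul_cocycle D c -> (forall a b, loc_nilp D (c a b)) ->
  exists y, forall a b, koszul_d D y a b = c a b.
Proof.
move=> cc cn.
suff [y [yn ye]] : exists y, (forall a, loc_nilp D (y a)) /\
    forall a b, a \in enum T -> koszul_d D y a b = c a b.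
  by exists y => a b; apply: ye; rewrite mem_enum.
elim: (enum T) => [|a r [y [yn ye]]].
  by exists (fun=> 0); split=> // a; apply: loc_nilp0.
have [ar|ar] := boolP (a \in r).
  exists y; split=> // b e; rewrite in_cons => /orP[/eqP->|]; exact: ye.
pose c' b e := c b e - koszul_d D y b e.
have c'c : koszul_cocycle D c' by apply/koszul_cocycleB/koszul_dd.
have c'n b e : loc_nilp D (c' b e).
  by apply: loc_nilpB => //; apply: loc_nilpB; apply: nilpD.
have c'r b e : b \in r -> c' b e = 0 by move=> br; rewrite /c' ye // subrr.
have c'0 b : c' b b = 0.
  by have /eqP := c'c.1 b b; rewrite -addr_eq0 -mulr2n => /eqP/natmul_eq0.
have [N cN] := loc_nilp_uniform (c'n a).
(* The rows b in r stay correct: there z b = 0, and D b (c' a e) = 0 by the cocycle identity, which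
   passes to the primitive. *)
pose z b := heis_int (D a) (X a) N (c' a b).
have z0 b : c' a b = 0 -> z b = 0.
  by rewrite /z => ->; apply: big1 => j _; rewrite !iter_linear0 scaler0.
exists (fun b => y b + z b); split=> [b|b e bar].
  by apply: loc_nilpD => //; apply: nilp_int.
rewrite koszul_dD; suff -> : koszul_d D z b e = c' b e by rewrite addrC subrK.
move: bar; rewrite in_cons => /predU1P[->|br].
  by rewrite /koszul_d (z0 _ (c'0 a)) linear0 subr0 heis_intK // DXa.
have ab : a != b by apply: contraNneq ar => ->.
rewrite c'r // /koszul_d (z0 b) ?linear0 ?subr0; last by rewrite (c'c.1 a b) (c'r b a br) oppr0.
rewrite int_comm //; have := c'c.2 b a e.
rewrite (c'c.1 e b) !(c'r b _ br) oppr0 !linear0 !addr0 => ->.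
by apply: big1 => j _; rewrite !iter_linear0 scaler0.
Qed.

End Poincare.

(** * The Koszul complex of independent multiplications *)

Section Regular.
Variables (F : numFieldType) (V : lmodType F) (T : finType).
Variables D X : T -> {linear V -> V}.
Hypothesis DD : forall a b f, D a (D b f) = D b (D a f).
Hypothesis XX : forall a b f, X a (X b f) = X b (X a f).
Hypothesis XD : forall a b f, X a (D b f) = D b (X a f) + (a == b)%:R *: f.

Let XDa a f : X a (D a f) = D a (X a f) + f.
Proof. by rewrite XD eqxx scale1r. Qed.

Let XDne a b f : a != b -> X a (D b f) = D b (X a f).
Proof. by move=> /negbTE ab; rewrite XD ab scale0r addr0. Qed.

Let nilpX a f : loc_nilp X f -> loc_nilp X (X a f).
Proof.
by apply: (@loc_nilp_op _ _ _ _ _ (fun=> 0)) => b g; rewrite XX scale0r addr0.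
Qed.

Let nilpD a f : loc_nilp X f -> loc_nilp X (D a f).
Proof. by apply: (@loc_nilp_op _ _ _ _ _ (fun b => (b == a)%:R)) => b g; rewrite XD. Qed.

Let nilp_div a N f : loc_nilp X f -> loc_nilp X (heis_div (X a) (D a) N f).
Proof.
move=> fn; apply: loc_nilp_sum => j; apply/loc_nilpZ/loc_nilp_iter; first exact: nilpD.
by apply: loc_nilp_iter fn; apply: nilpX.
Qed.

Let const_comm a b N f :
  a != b -> D b (heis_const (X a) (D a) N f) = heis_const (X a) (D a) N (D b f).
Proof.
move=> ab; rewrite linear_sum; apply: eq_bigr => j _.
rewrite linearZ; congr (_ *: _).
rewrite iter_comm => [|g]; last by rewrite DD.
by rewrite (iter_comm j f (T := D b)) // => g; rewrite XDne.
Qed.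

Let constB a N f g : heis_const (X a) (D a) N (f - g) =
  heis_const (X a) (D a) N f - heis_const (X a) (D a) N g.
Proof.
rewrite /heis_const -sumrB; apply: eq_bigr => j _.
by rewrite -scalerBr !iter_linearD !iter_linearN.
Qed.

Let inj a f : loc_nilp X f -> D a f = 0 -> f = 0.
Proof. by move=> [N fN]; apply: (heisenberg_inj (XDa a) (fN a)). Qed.

(** The D a now act as multiplications by variables and the X a as derivatives. Dividing u a1 by D
    a1 leaves a remainder u' a1 free of that variable, while D a (u' a1) = D a1 (u' a) is a multiple
    of it. Both sides thus vanish, so u' a = 0 for a <> a1, and the second index a2 then kills u'
    a1. *)
Lemma koszul_regular1 (a1 a2 : T) (I : pred T) (u : T -> V) :
    a1 != a2 -> I a1 -> I a2 -> (forall a, loc_nilp X (u a)) ->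
    (forall a b, I a -> I b -> D a (u b) = D b (u a)) ->
  exists2 v, loc_nilp X v & forall a, I a -> D a v = u a.
Proof.
move=> a12 I1 I2 un uc; have [N uN] := loc_nilp_uniform un.
pose v := heis_div (X a1) (D a1) N.+1 (u a1).
have vn : loc_nilp X v by apply: nilp_div.
pose u' a := u a - D a v.
have u'n a : loc_nilp X (u' a) by apply: loc_nilpB => //; apply: nilpD.
have u'c a b : I a -> I b -> D a (u' b) = D b (u' a).
  by move=> Ia Ib; rewrite !linearB uc // DD.
have u'1 : u' a1 = heis_const (X a1) (D a1) N.+1 (u a1).
  by rewrite /u' {1}(heis_divE (X a1) (D a1) N.+1 (u a1)) addrAC subrr add0r.
have u'0 a : I a -> a != a1 -> u' a = 0.
  move=> Ia aa1; apply: (inj (a := a1)) => //.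
  rewrite -(u'c a) // u'1 const_comm 1?eq_sym // uc // (heis_constQ (XDa a1)) //.
  exact: iter_eq0_leq (leqnSn N) (uN _ _).
have u'10 : u' a1 = 0.
  by apply: (inj (a := a2)) => //; rewrite u'c // u'0 1?eq_sym // linear0.
exists v => // a Ia; apply/esym/eqP; rewrite -subr_eq0; apply/eqP.
by have [->|] := eqVneq a a1; [exact: u'10 | exact: u'0].
Qed.

(** Division by D a1 makes the row c' a1 free of that variable, which forces the entries with both
    indices other than a1 to vanish. The row itself is then a closed 1-cochain on the other indices,
    and the degree 1 statement applies with a2 and a3. *)
Lemma koszul_regular2 (a1 a2 a3 : T) c :
    uniq [:: a1; a2; a3] ->
    koszul_cocycle D c -> (forall a b, loc_nilp X (c a b)) ->
  exists y, forall a b, koszul_d D y a b = c a b.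
Proof.
rewrite /= !inE negb_or => /andP[/andP[a12 a13] /andP[a23 _]] cc cn.
have [|N cN] := @loc_nilp_uniform _ _ _ X (T * T)%type (fun p => c p.1 p.2).
  by case.
have c0 b : c b b = 0.
  by have /eqP := cc.1 b b; rewrite -addr_eq0 -mulr2n => /eqP/natmul_eq0.
pose y b := heis_div (X a1) (D a1) N.+1 (c a1 b).
pose c' b e := c b e - koszul_d D y b e.
have y1 : y a1 = 0.
  by rewrite /y c0; apply: big1 => j _; rewrite !iter_linear0 scaler0.
have c'c : koszul_cocycle D c' by apply/koszul_cocycleB/koszul_dd.
have c'n b e : loc_nilp X (c' b e).
  by apply: loc_nilpB => //; apply: loc_nilpB; apply/nilpD/nilp_div.
have c'0 b : c' b b = 0 by rewrite /c' c0 /koszul_d !subrr.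
have c'1 b : c' a1 b = heis_const (X a1) (D a1) N.+1 (c a1 b).
  rewrite /c' /koszul_d y1 linear0 subr0.
  by rewrite {1}(heis_divE (X a1) (D a1) N.+1 (c a1 b)) addrAC subrr add0r.
have c'bc b e : b != a1 -> e != a1 -> c' b e = 0.
  move=> b1 e1; apply: (inj (a := a1)) => //.
  rewrite (koszul_cocycleE _ _ _ c'c) !c'1 !const_comm 1?eq_sym // -constB.
  rewrite -(koszul_cocycleE _ _ _ cc) (heis_constQ (XDa a1)) //.
  exact: iter_eq0_leq (leqnSn N) (cN (b, e) _).
have [|||||v vn vE] := @koszul_regular1 a2 a3 (predC1 a1) (c' a1).
- by [].
- by rewrite /= eq_sym.
- by rewrite /= eq_sym.
- exact: c'n.
- move=> b e b1 e1; apply/esym/eqP; rewrite -subr_eq0; apply/eqP.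
  by rewrite -(koszul_cocycleE _ _ _ c'c) c'bc // linear0.
(* The differential of a cochain supported at a1 with value -v has entry D e v at (a1, e), whence
   the sign. *)
pose z b := if b == a1 then - v else 0.
have zE b e : koszul_d D z b e = c' b e.
  rewrite /koszul_d /z; have [->|b1] := eqVneq b a1; have [->|e1] := eqVneq e a1.
  - by rewrite c'0 subrr.
  - by rewrite linear0 linearN sub0r opprK vE.
  - by rewrite c'c.1 linear0 subr0 linearN vE.
  - by rewrite !linear0 addr0 c'bc.
exists (fun b => y b + z b) => b e; rewrite koszul_dD.
by rewrite zE addrC subrK.
Qed.

End Regular.

(** * Identities in noncommutative rings *)

Section NoncommutativeRing.
Variable R : pzRingType.

(** The two instances open [non_commutative_ring] to every [pzRingType], with Leibniz equality. *)
#[global] Instance nc_ring_ops :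
  @Ring_ops R 0 1 +%R *%R (fun x y => x - y) -%R (@eq R) := {}.

#[global] Instance nc_ring : Ring (Ro := nc_ring_ops).
Proof.
split; try (by typeclasses eauto);
  cbv [zero_notation one_notation add_notation mul_notation opp_notation
       sub_notation eq_notation addition multiplication zero one equality
       opposite subtraction].
- exact: add0r.
- exact: addrC.
- exact: addrA.
- exact: mul1r.
- exact: mulr1.
- exact: mulrA.
- exact: mulrDl.
- by move=> *; exact: mulrDr.
- by [].
- exact: subrr.
Qed.

(** With L and R for left and right multiplication, [L_x + R_x, L_y + R_y] = L_[x,y] - R_[x,y],
    which is zero for scalar [x, y]. The next identity has L_[x,y] + R_[x,y] instead, which is then
    a scalar. *)
Lemma anticommutator_identity (x y f : R) :
  x * (y * f + f * y) + (y * f + f * y) * x -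
  (y * (x * f + f * x) + (x * f + f * x) * y) =
  (x * y - y * x) * f - f * (x * y - y * x).
Proof. non_commutative_ring. Qed.

Lemma mixed_commutator_identity (x y f : R) :
  x * (y * f + f * y) - (y * f + f * y) * x -
  (y * (x * f - f * x) + (x * f - f * x) * y) =
  (x * y - y * x) * f + f * (x * y - y * x).
Proof. non_commutative_ring. Qed.

(** Moving x across w costs a sign, which turns anticommutators into commutators and back. This is
    how an omega exchanges the two halves of the algebra. *)
Lemma commutator_mul_of_anti (w x f : R) : w * x = - (x * w) ->
  x * (w * f) - w * f * x = - (w * (x * f + f * x)).
Proof.
by move=> wx; rewrite mulrA -[x * w]opprK -wx; non_commutative_ring.
Qed.

Lemma anticommutator_mul_of_anti (w x f : R) : w * x = - (x * w) ->
  x * (w * f) + w * f * x = - (w * (x * f - f * x)).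
Proof.
by move=> wx; rewrite mulrA -[x * w]opprK -wx; non_commutative_ring.
Qed.

End NoncommutativeRing.

(** * Commutators and symmetrised multiplications as linear operators *)

Section CommutatorOperators.
Variables (F : comNzRingType) (A : algType F).
Implicit Types (x y w f : A) (c d : F).

Definition commutator x f := x * f - f * x.
Definition half_anti c x f := c *: (x * f + f * x).

Fact commutator_linear x : linear (commutator x).
Proof.
move=> c f g; rewrite /commutator mulrDr mulrDl -scalerAr -scalerAl opprD.
by rewrite addrACA -scalerBr.
Qed.
HB.instance Definition _ x :=
  GRing.isLinear.Build F A A *:%R (commutator x) (commutator_linear x).

Fact half_anti_linear c x : linear (half_anti c x).
Proof.
move=> d f g; rewrite /half_anti mulrDr mulrDl -scalerAr -scalerAl addrACA -scalerDr.
rewrite [LHS]scalerDr !scalerA. by rewrite [c * d]mulrC.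
Qed.
HB.instance Definition _ c x :=
  GRing.isLinear.Build F A A *:%R (half_anti c x) (half_anti_linear c x).

Lemma commutatorC x y e f : commutator x y = e%:A ->
  commutator x (commutator y f) = commutator y (commutator x f).
Proof.
move=> xy; apply/eqP; rewrite -subr_eq0; apply/eqP.
transitivity (commutator x y * f - f * commutator x y).
  rewrite /commutator; non_commutative_ring.
by rewrite xy mulr_algl mulr_algr subrr.
Qed.

Lemma commutator_half_anti c x y e f : commutator x y = e%:A ->
  commutator x (half_anti c y f) =
  half_anti c y (commutator x f) + (c * e *+ 2) *: f.
Proof.
move=> xy; apply/eqP; rewrite addrC -subr_eq; apply/eqP.
transitivity (c *: (commutator x y * f + f * commutator x y)).
  rewrite linearZ -scalerBr; congr (_ *: _); exact: mixed_commutator_identity.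
by rewrite xy mulr_algl mulr_algr -scalerDl scalerA mulrDr.
Qed.

Lemma half_antiC c d x y e f : commutator x y = e%:A ->
  half_anti c x (half_anti d y f) = half_anti d y (half_anti c x f).
Proof.
move=> xy; apply/eqP; rewrite -subr_eq0; apply/eqP.
transitivity ((c * d) *: (commutator x y * f - f * commutator x y)).
  rewrite /half_anti.
  rewrite -!scalerAr -!scalerAl -!scalerDr !scalerA (mulrC d c) -scalerBr.
  congr (_ *: _); exact: anticommutator_identity.
by rewrite xy mulr_algl mulr_algr subrr scaler0.
Qed.

Lemma commutator_anti_mul x w c f : w * x = - (x * w) ->
  c *: commutator x (w * f) = - (w * half_anti c x f).
Proof.
move=> wx; rewrite /half_anti -scalerAr -scalerN; congr (_ *: _).
exact: commutator_mul_of_anti.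
Qed.

Lemma half_anti_anti_mul x w c f : w * x = - (x * w) ->
  half_anti c x (w * f) = - c *: (w * commutator x f).
Proof.
move=> wx; rewrite scaleNr -scalerN /half_anti; congr (_ *: _).
exact: anticommutator_mul_of_anti.
Qed.

End CommutatorOperators.

(** * Exactness in degree 2 for a Clifford-Weyl algebra *)

Section CliffordWeylKoszul.
Variables (F : numFieldType) (A : algType F) (T : finType).
Variables (x : T -> A) (tau : T -> T) (eps : T -> F) (s : seq A).
Hypothesis tauK : involutive tau.
Hypothesis eps2 : forall a, eps a * eps a = 1.
Hypothesis xx : forall a b,
  commutator (x a) (x b) = (eps a * (b == tau a)%:R)%:A.
Hypothesis wx : forall w a, w \in s -> w * x a = - (x a * w).
Hypothesis gen : forall P : A -> Prop,
  P 1 -> (forall f g, P f -> P g -> P (f + g)) -> (forall c f, P f -> P (c *: f)) ->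
  (forall w f, w \in s -> P f -> P (w * f)) -> (forall a f, P f -> P (x a * f)) ->
  forall f, P f.

Let D a : {linear A -> A} := commutator (x a).
(** As [x_a, x_(tau a)] = eps_a and eps_a^2 = 1, the factor eps_a / 2 yields [D_a, X_b] = delta_ab.
    Its opposite Y satisfies [Y_a, D_b] = delta_ab, the form in which D plays the
    multiplications. *)
Let X a : {linear A -> A} := half_anti (eps a / 2) (x (tau a)).
Let Y a : {linear A -> A} := half_anti (- eps a / 2) (x (tau a)).

Let DD a b f : D a (D b f) = D b (D a f).
Proof. exact: commutatorC (xx a b). Qed.

Let YY a b f : Y a (Y b f) = Y b (Y a f).
Proof. exact: half_antiC (xx (tau a) (tau b)). Qed.

Let Dhalf_anti a b c f : D a (half_anti c (x (tau b)) f) =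
  half_anti c (x (tau b)) (D a f) + ((a == b)%:R * c * eps b *+ 2) *: f.
Proof.
rewrite /D /= (commutator_half_anti _ _ (xx a _)) (inj_eq (can_inj tauK)) eq_sym.
by have [->|_] := eqVneq a b; rewrite ?mulr1 ?mul1r // !(mulr0, mul0r).
Qed.

Let half2 : 2^-1 *+ 2 = 1 :> F.
Proof. by rewrite -[LHS]mulr_natr mulVf ?pnatr_eq0. Qed.

Let DX a b f : D a (X b f) = X b (D a f) + (a == b)%:R *: f.
Proof.
rewrite Dhalf_anti; congr (_ + _ *: _); have [_|_] := eqVneq a b.
  by rewrite mul1r mulrAC eps2 mul1r half2.
by rewrite !mul0r mul0rn.
Qed.

Let YD a b f : Y a (D b f) = D b (Y a f) + (a == b)%:R *: f.
Proof.
rewrite Dhalf_anti -addrA -scalerDl eq_sym -[LHS]addr0; congr (_ + _).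
have [_|_] := eqVneq a b; last by rewrite !mul0r mul0rn addr0 scale0r.
by rewrite mul1r mulrAC mulNr eps2 mulN1r mulNrn half2 addNr scale0r.
Qed.

Let left_mulE a f : x a * f = 2^-1 *: commutator (x a) f + half_anti 2^-1 (x a) f.
Proof.
rewrite /half_anti -scalerDr /commutator addrACA addNr addr0 -mulr2n.
by rewrite -scalerMnr scalerMnl half2 scale1r.
Qed.

(** Multiplication by w intertwines D_a with a multiple of Y_(tau a), so it sends Y-nilpotent
    vectors to D-nilpotent ones. *)
Let anti_iterD w a N f : w \in s ->
  exists d, iter N (D a) (w * f) = d *: (w * iter N (Y (tau a)) f).
Proof.
move=> sw; elim: N => [|N [d IH]]; first by exists 1; rewrite scale1r.
have e0 : - eps (tau a) / 2 != 0.
  rewrite mulf_neq0 ?invr_eq0 ?pnatr_eq0 // oppr_eq0; apply/eqP => e0.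
  by have /eqP := eps2 (tau a); rewrite e0 mul0r eq_sym oner_eq0.
have DwE g : D a (w * g) = - (- eps (tau a) / 2)^-1 *: (w * Y (tau a) g).
  rewrite scaleNr -scalerN; apply: (canRL (scalerK e0)).
  by rewrite /Y tauK (commutator_anti_mul _ _ (wx a sw)).
by eexists; rewrite iterS IH linearZ /= DwE scalerA.
Qed.

Let anti_iterY w a N f : w \in s ->
  exists d, iter N (Y a) (w * f) = d *: (w * iter N (D (tau a)) f).
Proof.
move=> sw; elim: N => [|N [d IH]]; first by exists 1; rewrite scale1r.
eexists; rewrite iterS IH linearZ /=.
by rewrite (half_anti_anti_mul _ _ (wx _ sw)) scalerA.
Qed.

(** The sum of the two halves contains 1, which all D_a kill, and is stable under left
    multiplication by the generators: an omega exchanges the halves, and x_a preserves each of them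
    by [left_mulE]. *)
Let nilp_decomp f :
  exists g, loc_nilp D g /\ loc_nilp Y (f - g).
Proof.
move: f; apply: gen => [|f f' [g [gD gY]] [g' [gD' gY']]|c f [g [gD gY]]
  |w f sw [g [gD gY]]|a f [g [gD gY]]].
- exists 1; rewrite subrr; split; last exact: loc_nilp0.
  by exists 1%N => a; rewrite /= /commutator mulr1 mul1r subrr.
- exists (g + g'); split; first exact: loc_nilpD.
  by rewrite opprD addrACA; apply: loc_nilpD.
- by exists (c *: g); rewrite -scalerBr; split; apply: loc_nilpZ.
(* The D-nilpotent part of w f is w times the Y-nilpotent part of f. *)
- exists (w * (f - g)); rewrite -mulrBr subKr; split.
    have [N gN] := gY; exists N => a; have [d ->] := anti_iterD a N (f - g) sw.
    by rewrite gN mulr0 scaler0.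
  have [N gN] := gD; exists N => a; have [d ->] := anti_iterY a N g sw.
  by rewrite gN mulr0 scaler0.
exists (x a * g); rewrite -mulrBr !left_mulE -[a]tauK; split; apply: loc_nilpD.
- apply: loc_nilpZ; apply: (loc_nilp_op (c := fun=> 0)) gD => b h.
  by rewrite scale0r addr0; apply: DD.
- by apply: loc_nilp_op gD => b h; apply: Dhalf_anti.
- apply: loc_nilpZ; apply: (loc_nilp_op (c := fun b => (b == tau (tau a))%:R)) gY => b h.
  exact: YD.
- apply: (loc_nilp_op (c := fun=> 0)) gY => b h; rewrite scale0r addr0.
  exact: half_antiC (xx _ _).
Qed.

(** One index a is asked for, since both conditions are vacuous when T is empty. *)
Let nilp_disjoint (a : T) f : loc_nilp D f -> loc_nilp Y f -> f = 0.
Proof.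
move=> [M fM] [N fN]; apply: (heisenberg_nilp _ (fN a) (fM a)) => g.
by rewrite YD eqxx scale1r.
Qed.

Lemma clifford_weyl_koszul (a1 a2 a3 : T) (c : T -> T -> A) :
    uniq [:: a1; a2; a3] -> koszul_cocycle D c ->
  exists y, forall a b, koszul_d D y a b = c a b.
Proof.
move=> a123 cc.
have [c0 c0P] := fin_all_exists (fun p : T * T => nilp_decomp (c p.1 p.2)).
pose c0' a b := c0 (a, b); pose c1 a b := c a b - c0' a b.
have c0D a b : loc_nilp D (c0' a b) by have [] := c0P (a, b).
have c1Y a b : loc_nilp Y (c1 a b) by have [] := c0P (a, b).
have nilpD a f : loc_nilp D f -> loc_nilp D (D a f).
  by apply: (loc_nilp_op (c := fun=> 0)) => b h; rewrite scale0r addr0; apply: DD.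
have nilpY a f : loc_nilp Y f -> loc_nilp Y (D a f).
  by apply: (loc_nilp_op (c := fun b => (b == a)%:R)) => b h; apply: YD.
(* Each defect of c0' is D-nilpotent. It is also minus the corresponding defect of c1, hence
   Y-nilpotent, and therefore zero. *)
have c0c : koszul_cocycle D c0'.
  split=> [a b|a b e]; [apply/eqP; rewrite -addr_eq0; apply/eqP|];
    apply: (nilp_disjoint a1).
  - exact: loc_nilpD.
  - rewrite -[_ + _]opprK -scaleN1r; apply: loc_nilpZ.
    have -> : - (c0' a b + c0' b a) = c1 a b + c1 b a.
      by rewrite /c1 addrACA -opprD (cc.1 a b) addNr sub0r.
    exact: loc_nilpD.
  - by apply/(loc_nilpD (loc_nilpD _ _)); apply: nilpD.
  - rewrite -[_ + _]opprK -scaleN1r; apply: loc_nilpZ.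
    suff -> : - (D a (c0' b e) + D b (c0' e a) + D e (c0' a b)) =
      D a (c1 b e) + D b (c1 e a) + D e (c1 a b).
      by apply/(loc_nilpD (loc_nilpD _ _)); apply: nilpY.
    rewrite (linearB (D a)) (linearB (D b)) (linearB (D e)).
    move: (cc.2 a b e); move: (D a (c b e)) (D b (c e a)) (D e (c a b)) => u v t.
    move: (D a _) (D b _) (D e _) => u' v' t' uvt.
    by rewrite [X in _ = X + _]addrACA -opprD addrACA -opprD uvt sub0r.
have c1c : koszul_cocycle D c1 by apply: koszul_cocycleB.
have [y0 y0E] := poincare DD DX c0c c0D.
have [y1 y1E] := koszul_regular2 DD YY YD a123 c1c c1Y.
exists (fun a => y0 a + y1 a) => a b.
by rewrite koszul_dD y0E y1E addrC subrK.
Qed.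

End CliffordWeylKoszul.

(** * Averaging under conjugation by involutions *)

Lemma commutator_conj_anti (R : pzRingType) (w x f : R) : w * x = - (x * w) ->
  - (x * (w * f * w) - w * f * w * x) = w * (x * f - f * x) * w.
Proof.
move=> wx; have xw : x * w = - (w * x) by rewrite wx opprK.
have -> : x * (w * f * w) = - (w * x * f * w) by rewrite !mulrA xw !mulNr.
have -> : w * f * w * x = - (w * f * x * w) by rewrite -mulrA wx mulrN mulrA.
non_commutative_ring.
Qed.

Section Averaging.
Variables (F : numFieldType) (A : algType F).
Implicit Types (w x y : A) (s : seq A).

Definition anticommute x y := x * y == - (y * x).

Definition involutions s := all (fun w => w * w == 1) s && pairwise anticommute s.

(** For w^2 = 1 this is the projection onto the elements that anticommute with w. *)
Definition average w x : A := 2^-1 *: (x - w * x * w).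

Definition averages s x := foldr average x s.

Lemma involutions_cons w s : involutions (w :: s) =
  [&& w * w == 1, all (anticommute w) s & involutions s].
Proof. by rewrite /involutions /= -!andbA; do !bool_congr. Qed.

Lemma anticommuteC x y : anticommute x y = anticommute y x.
Proof. by rewrite /anticommute eq_sym eqr_oppLR. Qed.

Lemma average_id w x : w * w = 1 -> anticommute w x -> average w x = x.
Proof.
move=> ww /eqP wx; rewrite /average wx mulNr -mulrA ww mulr1 opprK -mulr2n.
by rewrite -scaler_nat scalerA mulVf ?pnatr_eq0 // scale1r.
Qed.

Lemma average_anti w x : w * w = 1 -> anticommute w (average w x).
Proof.
move=> ww; apply/eqP; rewrite -scalerAr -scalerAl -scalerN; congr (_ *: _).
by rewrite mulrBr mulrBl !mulrA ww mul1r -(mulrA _ w w) ww mulr1 opprB.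
Qed.

(** Averaging over one involution keeps the anticommutation already gained with the others. *)
Lemma average_preserve v w x :
  anticommute v w -> anticommute v x -> anticommute v (average w x).
Proof.
move=> /eqP vw /eqP vx; apply/eqP; rewrite -scalerAr -scalerAl -scalerN.
have e : v * (w * x * w) = - (w * x * w * v).
  rewrite !mulrA vw !mulNr; congr (- _).
  by rewrite -(mulrA w v) vx mulrN mulNr mulrA -(mulrA _ v w) vw mulrN opprK mulrA.
by congr (_ *: _); rewrite mulrBr mulrBl e vx opprB opprK addrC.
Qed.

Lemma averages_anti s x : involutions s -> all (fun w => anticommute w (averages s x)) s.
Proof.
elim: s => // w s IH; rewrite involutions_cons => /and3P[/eqP ww ws /IH xs] /=.
rewrite average_anti //=; apply/allP => v vs; apply: average_preserve.
  by rewrite anticommuteC (allP ws).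
exact: (allP xs).
Qed.

Lemma averages_id s x : involutions s -> all (anticommute^~ x) s -> averages s x = x.
Proof.
elim: s => // w s IH; rewrite involutions_cons => /and3P[/eqP ww _ si] /=.
by move=> /andP[wx sx]; rewrite IH // average_id.
Qed.

End Averaging.

Arguments anticommute {F A} x y.

Lemma averages_morph (F : numFieldType) (A B : algType F) (rho : {lrmorphism B -> A}) s x :
  rho (averages s x) = averages (map rho s) (rho x).
Proof.
elim: s => //= w s IH; rewrite /average linearZ linearB /= !rmorphM /=.
by rewrite -IH.
Qed.

Lemma involutions_map (F : numFieldType) (A B : algType F) (rho : {lrmorphism B -> A}) s :
  involutions s -> involutions (map rho s).
Proof.
elim: s => //= w s IH; rewrite !involutions_cons => /and3P[/eqP ww ws /IH ->].
rewrite -rmorphM ww rmorph1 eqxx andbT /=; rewrite all_map.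
apply: sub_all ws => v /eqP wv.
by rewrite /= /anticommute -!rmorphM wv rmorphN.
Qed.

(** Averaging y over w replaces its differential c by (c + w c w) / 2, because each x a anticommutes
    with w; this is c again as c commutes with w. *)
Lemma koszul_d_averages (F : numFieldType) (A : algType F) (T : Type)
    (x y : T -> A) (c : T -> T -> A) (s : seq A) :
    involutions s -> (forall w a, w \in s -> w * x a = - (x a * w)) ->
    (forall w a b, w \in s -> w * c a b = c a b * w) ->
    (forall a b, koszul_d (fun a => commutator (x a) : {linear A -> A}) y a b = c a b) ->
  forall a b, koszul_d (fun a => commutator (x a) : {linear A -> A})
    (fun a => averages s (y a)) a b = c a b.
Proof.
move=> + + + yc; elim: s => // w s IH; rewrite involutions_cons => /and3P[/eqP ww _ si] wx wc a b.
have sub v : v \in s -> v \in w :: s by move=> vs; rewrite in_cons vs orbT.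
have {}IH := IH si (fun v a vs => wx v a (sub v vs)) (fun v a b vs => wc v a b (sub v vs)).
have av_comm e f : commutator (x e) (average w f) =
  2^-1 *: (commutator (x e) f + w * commutator (x e) f * w).
  rewrite linearZ linearB /=; congr (_ *: (_ + _)).
  exact: commutator_conj_anti (wx _ _ (mem_head _ _)).
rewrite /koszul_d /= !av_comm -scalerBr opprD addrACA -mulrBl -mulrBr.
rewrite [_ - _]IH wc ?mem_head // -mulrA ww mulr1 -mulr2n -scaler_nat scalerA.
by rewrite mulVf ?pnatr_eq0 // scale1r.
Qed.

(** * Lifting relations through powers of Lambda *)

Lemma newton_identity (R : pzRingType) (g : R) :
  (g + g + g - g * g * g) * (g + g + g - g * g * g) - (1 + 1 + 1 + 1) =
  (g * g - 1) * ((g * g - 1) * (g * g - (1 + 1 + 1 + 1))).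
Proof. non_commutative_ring. Qed.

Lemma newton_step (R : pzRingType) (g : R) :
  g + g + g - g * g * g - (g + g) = - (g * (g * g - 1)).
Proof. non_commutative_ring. Qed.

Lemma jacobi_identity (R : pzRingType) (x y z : R) :
  x * (y * z - z * y) - (y * z - z * y) * x +
  (y * (z * x - x * z) - (z * x - x * z) * y) +
  (z * (x * y - y * x) - (x * y - y * x) * z) = 0.
Proof. non_commutative_ring. Qed.

Section Lifting.
Variables (F : numFieldType) (A B : algType F).
Variables (rho : {lrmorphism B -> A}) (L : {linear B -> B}).

(** L stands for multiplication by Lambda on a deformation B of A. The hypotheses below make Lambda
    central and regular, with B / Lambda B = A, and B complete and separated. *)
Definition dvdL m x := exists y, x = iter m L y.

Hypothesis LMl : forall x y, L (x * y) = L x * y.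
Hypothesis LMr : forall x y, L (x * y) = x * L y.
Hypothesis L_inj : forall x, L x = 0 -> x = 0.
Hypothesis rho_surj : forall a, exists x, rho x = a.
Hypothesis rhoL : forall x, rho (L x) = 0.
Hypothesis rho_ker : forall x, rho x = 0 -> exists y, x = L y.
Hypothesis complete : forall u : nat -> B,
  (forall m, dvdL m.+1 (u m.+1 - u m)) -> exists h, forall m, dvdL m.+1 (h - u m).
Hypothesis separated : forall x, (forall m, dvdL m.+1 x) -> x = 0.

Let iterMl m x y : iter m L (x * y) = iter m L x * y.
Proof. by elim: m => //= m ->. Qed.

Let iterMr m x y : iter m L (x * y) = x * iter m L y.
Proof. by elim: m => //= m ->. Qed.

Let iter_inj m x : iter m L x = 0 -> x = 0.
Proof. by elim: m => //= m IH /L_inj. Qed.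

Let iterB m x y : iter m L (x - y) = iter m L x - iter m L y.
Proof. by rewrite iter_linearD iter_linearN. Qed.

Let dvdLD m x y : dvdL m x -> dvdL m y -> dvdL m (x + y).
Proof. by move=> [x' ->] [y' ->]; exists (x' + y'); rewrite iter_linearD. Qed.

Let dvdLZ m c x : dvdL m x -> dvdL m (c *: x).
Proof. by move=> [x' ->]; exists (c *: x'); rewrite iter_linearZ. Qed.

Let dvdLN m x : dvdL m x -> dvdL m (- x).
Proof. by move=> [x' ->]; exists (- x'); rewrite iter_linearN. Qed.

Let dvdLMl m x y : dvdL m x -> dvdL m (x * y).
Proof. by move=> [x' ->]; exists (x' * y); rewrite iterMl. Qed.

Let dvdLMr m x y : dvdL m y -> dvdL m (x * y).
Proof. by move=> [y' ->]; exists (x * y'); rewrite iterMr. Qed.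

Let dvdL_rho m x : dvdL m.+1 x -> rho x = 0.
Proof. by move=> [y ->]; rewrite /= rhoL. Qed.

Let dvdL_succ m x : rho x = 0 -> dvdL m.+1 (iter m L x).
Proof. by move=> /rho_ker[y ->]; exists y; rewrite -iterSr. Qed.

Let anti_limit x v :
  (forall m, exists2 z, anticommute x z & dvdL m.+1 (v - z)) -> anticommute x v.
Proof.
move=> lim; rewrite /anticommute -addr_eq0; apply/eqP/separated => m.
have [z /eqP xz vz] := lim m.
have -> : x * v + v * x = x * (v - z) + (v - z) * x.
  by rewrite mulrBr mulrBl xz opprK addrACA addrN addr0.
by apply: dvdLD; [apply: dvdLMr | apply: dvdLMl].
Qed.

(** The common successive approximation: Q m says that a family solves the problem modulo
    Lambda^(m+1). The index type Y is [unit] for one omega and T for the p's and q's. *)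
Lemma lift_limit (Y : Type) (Q : nat -> (Y -> B) -> Prop) g :
    (forall m g, Q m g -> exists2 h, Q m.+1 h & forall t, dvdL m.+1 (h t - g t)) ->
    Q 0%N g ->
  exists h, forall m, exists2 g', Q m g' & forall t, dvdL m.+1 (h t - g' t).
Proof.
move=> step Qg.
have /choice [f fP] : forall p : nat * (Y -> B), exists h,
    Q p.1 p.2 -> Q p.1.+1 h /\ forall t, dvdL p.1.+1 (h t - p.2 t).
  (* Outside Q the value u is an arbitrary default that makes the choice function total. *)
  move=> [m u]; have [Qu|nQ] := pselect (Q m u); last by exists u.
  by have [h Qh hu] := step m u Qu; exists h.
pose G := fix G m := if m is n.+1 then f (n, G n) else g.
have QG m : Q m (G m) by elim: m => //= m IH; have [] := fP (m, G m) IH.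
have /choice [h hP] : forall t, exists h, forall m, dvdL m.+1 (h - G m t).
  by move=> t; apply: complete => m; have [_] := fP (m, G m) (QG m); apply.
by exists h => m; exists (G m).
Qed.

(** Newton iteration for g^2 = 1: with h = (3g - g^3) / 2, 4(h^2 - 1) = (g^2 - 1)^2 (g^2 - 4), so
    the error is squared. The start is an averaged lift, which anticommutes with s. *)
Lemma lift_involution (w : A) (s : seq B) :
    involutions s -> w * w = 1 -> all (anticommute^~ w) (map rho s) ->
  exists v, [/\ rho v = w, v * v = 1 & all (anticommute^~ v) s].
Proof.
move=> si ww sw; have [v0 v0w] := rho_surj w.
pose Q m (g : unit -> B) := [/\ rho (g tt) = w,
  all (anticommute^~ (g tt)) s & dvdL m.+1 (g tt * g tt - 1)].
have [||v vP] := @lift_limit unit Q (fun=> averages s v0).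
- move=> m g; set u := g tt => -[uw us [e ue]].
  pose h := 2^-1 *: (u + u + u - u * u * u).
  have uu : 2^-1 *: (u + u) = u.
    by rewrite -mulr2n -scaler_nat scalerA mulVf ?pnatr_eq0 // scale1r.
  have hu : h - u = - (2^-1 *: (u * (u * u - 1))).
    by rewrite -scalerN -newton_step scalerBr uu.
  have hud : dvdL m.+1 (h - u).
    by rewrite hu; apply/dvdLN/dvdLZ/dvdLMr; exists e.
  exists (fun=> h); last by case; apply: hud.
  split.
  + by apply/eqP; rewrite -subr_eq0 -uw -rmorphB; apply/eqP; apply: dvdL_rho hud.
  + apply/allP => x xs; have /eqP xu : anticommute x u := allP us x xs.
    rewrite /anticommute -scalerAr -scalerAl -scalerN; apply/eqP; congr (_ *: _).
    (* The iteration is odd in u, so anticommutation with s survives. *)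
    have xu3 : x * (u * u * u) = - (u * u * u * x).
      rewrite !mulrA xu !mulNr -(mulrA u x) xu mulrN mulNr opprK mulrA.
      by rewrite -(mulrA _ x u) xu mulrN mulrA.
    by rewrite mulrBr mulrBl !mulrDr !mulrDl xu3 xu !opprD.
  + have four : 1 = (2^-1 * 2^-1) *: (1 + 1 + 1 + 1) :> B.
      have -> : 1 + 1 + 1 + 1 = (2 * 2)%:R *: 1 :> B by rewrite scaler_nat -!addrA.
      by rewrite scalerA natrM mulrACA mulVf ?pnatr_eq0 // mulr1 scale1r.
    rewrite /h -scalerAl -scalerAr scalerA [X in _ - X]four -scalerBr newton_identity.
    (* One factor u^2 - 1 supplies Lambda^(m+1) and the other a further Lambda. *)
    apply: dvdLZ; rewrite ue -iterMl; apply: dvdL_succ.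
    by rewrite -iterMl rmorphM /= rhoL mulr0.
- have aw : rho (averages s v0) = w.
    rewrite averages_morph v0w averages_id //.
    exact: involutions_map.
  split=> //; first exact: averages_anti.
  have /rho_ker [e ->] : rho (averages s v0 * averages s v0 - 1) = 0; last by exists e.
  by rewrite rmorphB rmorphM /= aw ww rmorph1 subrr.
exists (v tt); split.
- have [z [zw _ _] vz] := vP 0%N; apply/eqP.
  by rewrite -subr_eq0 -zw -rmorphB; apply/eqP; apply: dvdL_rho (vz tt).
- apply/eqP; rewrite -subr_eq0; apply/eqP/separated => m.
  have [z [_ _ zz] vz] := vP m.
  have -> : v tt * v tt - 1 =
      (v tt - z tt) * v tt + z tt * (v tt - z tt) + (z tt * z tt - 1).
    by non_commutative_ring.
  by apply: dvdLD => //; apply: dvdLD; [apply: dvdLMl | apply: dvdLMr].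
apply/allP => x xs; apply: anti_limit => m.
by have [z [_ sz _] vz] := vP m; exists (z tt) => //; apply: (allP sz).
Qed.

Lemma lift_involutions (s : seq A) :
  involutions s -> exists2 t : seq B, map rho t = s & involutions t.
Proof.
elim: s => [|w s IH]; first by exists [::].
rewrite involutions_cons => /and3P[/eqP ww ws /IH[t ts ti]].
have [|v [vw vv tv]] := lift_involution ti ww.
  by rewrite ts; apply: sub_all ws => x; rewrite anticommuteC.
exists (v :: t); first by rewrite /= vw ts.
rewrite involutions_cons vv eqxx ti andbT /=.
by apply: sub_all tv => x; rewrite anticommuteC.
Qed.

Let iter_commutator m x y : commutator x (iter m L y) = iter m L (commutator x y).
Proof. by rewrite /commutator iterB iterMr iterMl. Qed.

Let iter_commutatorl m x y : commutator (iter m L x) y = iter m L (commutator x y).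
Proof. by rewrite /commutator iterB (iterMl _ x y) (iterMr _ y x). Qed.

Let rho_commutator x y : rho (commutator x y) = commutator (rho x) (rho y).
Proof. by rewrite /commutator rmorphB !rmorphM. Qed.

(** The error of order m+1 in the commutators reduces to a 2-cocycle modulo Lambda, by the Jacobi
    identity; a primitive of it gives the correction of order m+1. *)
Lemma lift_heisenberg (T : Type) (x : T -> A) (om : T -> T -> F) (s : seq B) :
    involutions s -> (forall a, all (anticommute^~ (x a)) (map rho s)) ->
    (forall a b, commutator (x a) (x b) = (om a b)%:A) ->
    (forall a b, om a b = - om b a) ->
    (forall c, koszul_cocycle (fun a => commutator (x a) : {linear A -> A}) c ->
      exists y, forall a b,
        koszul_d (fun a => commutator (x a) : {linear A -> A}) y a b = c a b) ->
  exists g : T -> B, [/\ forall a, rho (g a) = x a,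
    forall a, all (anticommute^~ (g a)) s &
    forall a b, commutator (g a) (g b) = (om a b)%:A].
Proof.
move=> si sx xx omN exact_x.
have /choice [g0 g0x] := fun a => rho_surj (x a).
have lift_anti y : all (anticommute^~ (rho y)) (map rho s) ->
    rho (averages s y) = rho y.
  by move=> sy; rewrite averages_morph averages_id //; apply: involutions_map.
pose Q m (g : T -> B) := [/\ forall a, rho (g a) = x a,
  forall a, all (anticommute^~ (g a)) s &
  forall a b, dvdL m.+1 (commutator (g a) (g b) - (om a b)%:A)].
have [||g gP] := @lift_limit T Q (fun a => averages s (g0 a)).
- move=> m g [gx sg gg].
  (* Here e is the error divided by Lambda^(m+1); its identities follow from those of the error by
     injectivity of L. *)
  have /choice [e eE] : forall p : T * T, exists e,
      commutator (g p.1) (g p.2) - (om p.1 p.2)%:A = iter m.+1 L e.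
    by move=> p; apply: gg.
  have eN a b : e (a, b) = - e (b, a).
    apply/eqP; rewrite -addr_eq0; apply/eqP/(@iter_inj m.+1).
    rewrite iter_linearD -!eE /= omN scaleNr opprK addrACA addrN addr0.
    by rewrite /commutator addrC addrA subrK subrr.
  have comm_cst c u : commutator u c%:A = 0.
    by rewrite /commutator mulr_algl mulr_algr subrr.
  have gE u a b : commutator u (iter m.+1 L (e (a, b))) =
      commutator u (commutator (g a) (g b)).
    by rewrite -eE linearB /= comm_cst subr0.
  have eJ a b d : commutator (g a) (e (b, d)) + commutator (g b) (e (d, a)) +
      commutator (g d) (e (a, b)) = 0.
    apply: (@iter_inj m.+1); rewrite 2!iter_linearD -!iter_commutator !gE.
    exact: jacobi_identity.
  have ew a b w : w \in s -> w * e (a, b) = e (a, b) * w.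
    move=> ws; apply/eqP; rewrite -subr_eq0; apply/eqP/(@iter_inj m.+1).
    rewrite -[_ - _]/(commutator w _) -iter_commutator gE.
    have h u v : w * g u * g v = g u * g v * w.
      have /eqP wu : anticommute w (g u) := allP (sg u) w ws.
      have /eqP wv : anticommute w (g v) := allP (sg v) w ws.
      by rewrite wu mulNr -(mulrA _ w) wv mulrN opprK mulrA.
    by rewrite /commutator mulrBr mulrBl !mulrA !h subrr.
  have [|y yE] := exact_x (fun a b => - rho (e (a, b))).
    split=> [a b|a b d]; first by rewrite eN rmorphN.
    rewrite !linearN /= -!gx -!rho_commutator -!opprD -!rmorphD eJ.
    by rewrite rmorph0 oppr0.
  have sA := involutions_map rho si.
  (* The omegas commute with e, as they anticommute with each g a, so the primitive may be
     averaged. *)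
  have y'E := koszul_d_averages sA _ _ yE.
  pose y' a := averages (map rho s) (y a).
  have /choice [z zy] := fun a => rho_surj (y' a).
  pose z' a := averages s (z a).
  have z'y a : rho (z' a) = y' a.
    by rewrite lift_anti zy //; apply: averages_anti.
  exists (fun a => g a + iter m.+1 L (z' a)); last first.
    by move=> a; rewrite addrC addKr; exists (z' a).
  split=> [a|a|a b].
  + by rewrite rmorphD /= rhoL addr0.
  + apply/allP => w ws; have /eqP wg : anticommute w (g a) := allP (sg a) w ws.
    have /eqP wz : anticommute w (z' a) := allP (averages_anti (z a) si) w ws.
    by apply/eqP; rewrite mulrDr mulrDl -iterMr -iterMl wz wg iter_linearN opprD.
  (* Modulo Lambda the bracket on the right is rho e plus the differential of y', which is -rho e;
     the quadratic term still carries Lambda^(m+1). *)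
  + have -> : commutator (g a + iter m.+1 L (z' a)) (g b + iter m.+1 L (z' b))
        - (om a b)%:A = iter m.+1 L (e (a, b) + (commutator (g a) (z' b)
          - commutator (g b) (z' a)) + commutator (z' a) (iter m.+1 L (z' b))).
      rewrite 3!iter_linearD iter_linearN -(iter_commutatorl _ (z' a)).
      rewrite -!iter_commutator -eE /commutator.
      non_commutative_ring.
    apply: dvdL_succ; rewrite 2!rmorphD rmorphB /= !rho_commutator rhoL !gx !z'y.
    rewrite {3}/commutator mulr0 mul0r subrr addr0.
    have := y'E _ _ a b; rewrite /koszul_d /= => ->; first by rewrite addrN.
      by move=> w u ws; have /eqP := allP (sx u) w ws.
    move=> _ u v /mapP[w ws ->].
    by rewrite mulrN mulNr -!rmorphM ew.
- split=> [a|a|a b].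
  + by rewrite lift_anti g0x //; apply: sx.
  + exact: averages_anti.
  + have /rho_ker [e ->] : rho (commutator (averages s (g0 a)) (averages s (g0 b))
        - (om a b)%:A) = 0; last by exists e.
    rewrite rmorphB /= rho_commutator !lift_anti ?g0x //; try exact: sx.
    by rewrite xx rmorph_alg subrr.
exists g; split=> [a|a|a b].
- have [z [zx _ _] gz] := gP 0%N; apply/eqP.
  by rewrite -subr_eq0 -zx -rmorphB; apply/eqP; apply: dvdL_rho (gz a).
- apply/allP => x0 x0s; apply: anti_limit => m.
  have [z [_ sz _] gz] := gP m; exists (z a) => //.
  exact: (allP (sz a)).
apply/eqP; rewrite -subr_eq0; apply/eqP/separated => m.
have [z [_ _ zz] gz] := gP m.
have -> : commutator (g a) (g b) - (om a b)%:A =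
    (g a - z a) * g b + z a * (g b - z b) - ((g b - z b) * g a + z b * (g a - z a))
    + (commutator (z a) (z b) - (om a b)%:A).
  by rewrite /commutator; non_commutative_ring.
apply: dvdLD => //; apply: dvdLD; last apply: dvdLN; apply: dvdLD;
  by [apply: dvdLMl | apply: dvdLMr].
Qed.

Lemma lift_clifford_heisenberg (T : Type) (x : T -> A) (om : T -> T -> F) (s : seq A) :
    involutions s -> (forall a, all (anticommute^~ (x a)) s) ->
    (forall a b, commutator (x a) (x b) = (om a b)%:A) ->
    (forall a b, om a b = - om b a) ->
    (forall c, koszul_cocycle (fun a => commutator (x a) : {linear A -> A}) c ->
      exists y, forall a b,
        koszul_d (fun a => commutator (x a) : {linear A -> A}) y a b = c a b) ->
  exists (t : seq B) (g : T -> B), [/\ map rho t = s /\ involutions t,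
    forall a, rho (g a) = x a, forall a, all (anticommute^~ (g a)) t &
    forall a b, commutator (g a) (g b) = (om a b)%:A].
Proof.
move=> /lift_involutions[t ts ti] sx xx omN exact_x; rewrite -ts in sx.
by have [g [gx tg gg]] := lift_heisenberg ti sx xx omN exact_x; exists t, g.
Qed.

End Lifting.

(** * Universal property of the free algebra *)

Section FreeAlgebraUniversal.
Variables (C : comNzRingType) (G : choiceType).

Lemma free_alg_ind (P : free_alg C G -> Prop) :
    P 1 -> (forall x y, P x -> P y -> P (x + y)) -> (forall c x, P x -> P (c *: x)) ->
    (forall g x, P x -> P (free_gen C g * x)) ->
  forall x, P x.
Proof.
move=> P1 PD PZ Pg x; rewrite [x]monalgE; elim/big_rec: _ => [|m y _].
  by rewrite -(scale0r 1); apply: PZ.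
apply: PD; have -> : << x@_m *g m >> = x@_m *: << m >> :> free_alg C G.
  by rewrite -[RHS]mul_malgC [RHS]fgmulUU mulr1 mul1m.
apply: PZ; case: m => m; elim: m => [|g m IH]; first by rewrite -fmoneE.
have -> : FMonom (g :: m) = fmmul (fmu g) (FMonom m) by rewrite fmmulE fmuE.
have -> : << fmmul (fmu g) (FMonom m) >> = free_gen C g * << FMonom m >> :> free_alg C G.
  by rewrite [RHS]fgmulUU mulr1.
exact: Pg.
Qed.

Variables (B : algType C) (h : G -> B).

Definition fmonom_eval (m : {fmonom G}) : B := \prod_(g <- m) h g.

Fact fmonom_eval_multiplicative : mmorphism fmonom_eval.
Proof.
by split=> [m m'|]; rewrite /fmonom_eval ?fmM ?big_cat ?fm1 ?big_nil.
Qed.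

HB.instance Definition _ :=
  isMultiplicative.Build _ _ fmonom_eval fmonom_eval_multiplicative.

Definition free_eval : free_alg C G -> B := mmap (in_alg B) fmonom_eval.

Fact free_eval_linear : linear free_eval.
Proof. by move=> c x y; rewrite /free_eval mmapD mmapZ mulr_algl. Qed.

(** The general criterion for [mmap] asks that images of coefficients commute with images of
    monomials; here they are scalars. *)
Fact free_eval_multiplicative : monoid_morphism free_eval.
Proof.
have mult := @commr_mmap_is_multiplicative _ _ _ (in_alg B) fmonom_eval.
split; first by apply: (mult _).2 => g m m'; rewrite /GRing.comm mulr_algl mulr_algr.
by apply: (mult _).1 => g m m'; rewrite /GRing.comm mulr_algl mulr_algr.
Qed.

HB.instance Definition _ :=
  GRing.isLinear.Build C (free_alg C G) B *:%R free_eval free_eval_linear.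
HB.instance Definition _ :=
  GRing.isMonoidMorphism.Build (free_alg C G) B free_eval free_eval_multiplicative.

Lemma free_eval_gen g : free_eval (free_gen C g) = h g.
Proof. by rewrite /free_eval mmapU /= scale1r mul1r /fmonom_eval fmU big_seq1. Qed.

End FreeAlgebraUniversal.

(** * Universal property of the Clifford-Weyl algebra *)

Section CliffordWeylUniversal.
Variables (C : comNzRingType) (n k : nat) (B : algType C).
Local Notation A := (clifford_weyl C n k).

Definition cw_pi : free_alg C (cw_index n k) -> A := @quot_pi _ _ _.
Definition cw_gen (g : cw_index n k) : A := cw_pi (free_gen C g).

Fact cw_pi_linear : linear cw_pi.
Proof. by move=> c x y; rewrite /cw_pi quot_piD quot_piZ. Qed.
HB.instance Definition _ := GRing.isLinear.Build C _ A *:%R cw_pi cw_pi_linear.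

Fact cw_pi_multiplicative : monoid_morphism cw_pi.
Proof. by split=> [|x y]; rewrite /cw_pi ?quot_piM. Qed.
HB.instance Definition _ := GRing.isMonoidMorphism.Build _ A cw_pi cw_pi_multiplicative.

Lemma cw_ind (P : A -> Prop) :
    P 1 -> (forall x y, P x -> P y -> P (x + y)) -> (forall c x, P x -> P (c *: x)) ->
    (forall g x, P x -> P (cw_gen g * x)) ->
  forall x, P x.
Proof.
move=> P1 PD PZ Pg y; have [x ->] := quot_pi_surj y.
apply: (free_alg_ind (P := fun x => P (cw_pi x))) => [|u v|c u|g u].
- by rewrite rmorph1.
- by rewrite linearD; apply: PD.
- by rewrite linearZ; apply: PZ.
by rewrite rmorphM; apply: Pg.
Qed.

Lemma cw_rel_pi r : cw_rel r -> cw_pi r = 0.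
Proof.
move=> rr; rewrite -[RHS](quot_pi0 (cw_rel (C := C) (n := n) (k := k))).
apply/quot_piP; rewrite subr0 -[r]mul1r -[_ * r]mulr1.
exact: ideal_genM.
Qed.

Lemma cw_lift (h : cw_index n k -> B) :
    (forall r, cw_rel r -> free_eval h r = 0) ->
  exists s : {lrmorphism A -> B}, forall g, s (cw_gen g) = h g.
Proof.
move=> hr.
have h0 x : ideal_gen (@cw_rel C n k) x -> free_eval h x = 0.
  elim=> [|y z _ yE _ zE|a r b rr]; first exact: rmorph0.
    by rewrite rmorphD /= yE zE addr0.
  by rewrite !rmorphM /= (hr r rr) mulr0 mul0r.
(* Representatives are arbitrary: the evaluation kills the ideal, so s does not depend on them. *)
have /choice [rep repK] : forall y : A, exists x, y = cw_pi x by exact: quot_pi_surj.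
pose s y := free_eval h (rep y).
have sE x : s (cw_pi x) = free_eval h x.
  apply/eqP; rewrite -subr_eq0 /s -rmorphB /= h0 //.
  by apply/quot_piP; rewrite -[LHS]repK.
have sL : linear s.
  move=> c x y; rewrite [x]repK [y]repK -linearZ -linearD !sE.
  by rewrite linearD linearZ.
have sM : monoid_morphism s.
  split=> [|x y]; first by rewrite -(rmorph1 cw_pi) sE rmorph1.
  by rewrite [x]repK [y]repK -rmorphM !sE rmorphM.
pose s1 := GRing.isLinear.Build C A B *:%R s sL.
pose s2 := GRing.isMonoidMorphism.Build A B s sM.
pose S : {lrmorphism A -> B} := HB.pack s s1 s2.
by exists S => g; rewrite /= sE free_eval_gen.
Qed.

End CliffordWeylUniversal.

(** * Power series as modules *)

Section PowerSeriesModule.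
Variables (F : comNzRingType) (V : lmodType F).
Implicit Types f g : fps V.

Definition fps_var : fps F := Fps (fun m => (m == 1)%:R).
Definition fps_shift f := Fps (fun m => coefs f m.+1).

Lemma coefsD f g m : coefs (f + g) m = coefs f m + coefs g m.
Proof. by []. Qed.

Lemma coefs_varZ f m : coefs (fps_var *: f) m = if m is n.+1 then coefs f n else 0.
Proof.
rewrite /=; case: m => [|m]; rewrite big_ord_recl /= scale0r ?big_ord0 ?addr0 //.
rewrite add0r big_ord_recl /= scale1r subn1 big1 ?addr0 // => i _.
by rewrite scale0r.
Qed.

Lemma coefs_fpsCZ c f m : coefs (fpsC c *: f) m = c *: coefs f m.
Proof. by rewrite [LHS]conv_fpsCl // => v; rewrite scale0r. Qed.

Lemma fps_split f : f = fpsC (coefs f 0) + fps_var *: fps_shift f.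
Proof.
apply/fpsP => m; rewrite coefsD coefs_varZ.
by case: m => [|m]; rewrite /= ?addr0 ?add0r.
Qed.

End PowerSeriesModule.

(** No continuity is assumed: writing f = f_0 + Lambda f', coefficient m of S f is determined by S
    f_0 and coefficient m - 1 of S f'. *)
Lemma fps_linear_ext (F : comNzRingType) (U V : lmodType F) (S T : fps U -> fps V) :
    (forall f g, S (f + g) = S f + S g) -> (forall f g, T (f + g) = T f + T g) ->
    (forall f, S (fps_var F *: f) = fps_var F *: S f) ->
    (forall f, T (fps_var F *: f) = fps_var F *: T f) ->
    (forall a, S (fpsC a) = T (fpsC a)) ->
  forall f, S f = T f.
Proof.
move=> SD TD SZ TZ ST f; apply/fpsP => m; elim: m f => [|m IH] f;
  rewrite (fps_split f) SD TD SZ TZ ST !coefsD !coefs_varZ //.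
by rewrite IH.
Qed.

(** * A deformation as a complete algebra over the ground field *)

Section DeformedAlgebra.
Variables (F : numFieldType) (A : algType F) (star : fps A -> fps A -> fps A).

(** An alias of [fps A], so that the product star does not clash with the undeformed ring
    structure. *)
Definition deformed of deformation star : Type := fps A.

Variable H : deformation star.

Let starDl f g h : star (f + g) h = star f h + star g h.
Proof. by have := (deformation_bilinear H).1 h 1 f g; rewrite /= !scale1r. Qed.

Let starDr f g h : star f (g + h) = star f g + star f h.
Proof. by have := (deformation_bilinear H).2 f 1 g h; rewrite /= !scale1r. Qed.

Let star0l h : star 0 h = 0.
Proof. by apply: (@addrI _ (star 0 h)); rewrite -starDl !addr0. Qed.

Let star0r f : star f 0 = 0.
Proof. by apply: (@addrI _ (star f 0)); rewrite -starDr !addr0. Qed.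

Let starZl c f h : star (c *: f) h = c *: star f h.
Proof. by have := (deformation_bilinear H).1 h c f 0; rewrite /= !addr0 star0l addr0. Qed.

Let starZr c f h : star f (c *: h) = c *: star f h.
Proof. by have := (deformation_bilinear H).2 f c h 0; rewrite /= !addr0 star0r addr0. Qed.

Definition deformed_one : deformed H := projT1 (cid (deformation_unital H)).

Let star1l f : star deformed_one f = f.
Proof. by rewrite /deformed_one; case: cid => e [el er] /=; apply: el. Qed.

Let star1r f : star f deformed_one = f.
Proof. by rewrite /deformed_one; case: cid => e [el er] /=; apply: er. Qed.

Let coefs0_star f g : coefs (star f g) 0%N = coefs f 0%N * coefs g 0%N.
Proof.
have [Omega [_ starE]] := deformation_form H.
rewrite {1}(fps_split f) {1}(fps_split g) starDl !starDr !starZl starZr starE.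
by rewrite !coefsD !coefs_varZ !addr0.
Qed.

Let coefs0_one : coefs deformed_one 0%N = 1.
Proof.
have := star1l (fpsC 1); move/(congr1 (fun f => coefs f 0%N)).
by rewrite coefs0_star mulr1.
Qed.

Let one_neq0 : deformed_one != 0 :> fps A.
Proof.
apply/eqP => /(congr1 (fun f => coefs f 0%N)); rewrite coefs0_one /= => /eqP.
by rewrite oner_eq0.
Qed.

HB.instance Definition _ := GRing.Zmodule.on (deformed H).
HB.instance Definition _ := GRing.Zmodule_isNzRing.Build (deformed H)
  (deformation_assoc H) star1l star1r starDl starDr one_neq0.

(** Scalars are restricted to constants; Lambda acts through [deformed_var]. *)
Let scale (c : F) (f : deformed H) : deformed H := fpsC c *: (f : fps A).

Let coefs_scale c f m : coefs (scale c f) m = c *: coefs f m.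
Proof. exact: coefs_fpsCZ. Qed.

Let scaleA a b v : scale a (scale b v) = scale (a * b) v.
Proof. by apply/fpsP => m; rewrite !coefs_scale scalerA. Qed.
Let scale1 : left_id 1 scale.
Proof. by move=> v; apply/fpsP => m; rewrite coefs_scale scale1r. Qed.
Let scaleDr : right_distributive scale +%R.
Proof. by move=> c u v; apply/fpsP => m; rewrite coefsD !coefs_scale -scalerDr. Qed.
Let scaleDl v : {morph scale^~ v : a b / a + b}.
Proof. by move=> a b; apply/fpsP => m; rewrite coefsD !coefs_scale -scalerDl. Qed.

HB.instance Definition _ := GRing.Zmodule_isLmodule.Build F (deformed H)
  scaleA scale1 scaleDr scaleDl.

Let scaleAl (c : F) (f g : deformed H) : c *: (f * g) = c *: f * g.
Proof. exact/esym/starZl. Qed.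
Let scaleAr (c : F) (f g : deformed H) : c *: (f * g) = f * (c *: g).
Proof. exact/esym/starZr. Qed.

HB.instance Definition _ := GRing.Lmodule_isLalgebra.Build F (deformed H) scaleAl.
HB.instance Definition _ := GRing.Lalgebra_isAlgebra.Build F (deformed H) scaleAr.

Definition deformed_coef m (f : deformed H) : A := coefs f m.

Fact deformed_coef_linear m : linear (deformed_coef m).
Proof. by move=> c f g; rewrite /deformed_coef coefsD coefs_scale. Qed.
HB.instance Definition _ m :=
  GRing.isLinear.Build F (deformed H) A *:%R (deformed_coef m) (deformed_coef_linear m).

Definition deformed_rho : deformed H -> A := deformed_coef 0.
HB.instance Definition _ := GRing.Linear.on deformed_rho.

Fact deformed_rho_multiplicative : monoid_morphism deformed_rho.
Proof. by split=> [|f g]; [exact: coefs0_one | exact: coefs0_star]. Qed.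
HB.instance Definition _ :=
  GRing.isMonoidMorphism.Build (deformed H) A deformed_rho deformed_rho_multiplicative.

Definition deformed_var (f : deformed H) : deformed H := fps_var F *: (f : fps A).

Fact deformed_var_linear : linear deformed_var.
Proof.
move=> c f g; apply/fpsP => m; rewrite [RHS]coefsD coefs_scale !coefs_varZ.
by case: m => [|m]; rewrite ?scaler0 ?addr0 // coefsD coefs_scale.
Qed.
HB.instance Definition _ := GRing.isLinear.Build F (deformed H) (deformed H) *:%R
  deformed_var deformed_var_linear.

Lemma deformed_varMl (f g : deformed H) : deformed_var (f * g) = deformed_var f * g.
Proof. exact/esym/starZl. Qed.

Lemma deformed_varMr (f g : deformed H) : deformed_var (f * g) = f * deformed_var g.
Proof. exact/esym/starZr. Qed.

Lemma iter_deformed_var n (f : deformed H) m :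
  coefs (iter n deformed_var f) m = if (m < n)%N then 0 else coefs f (m - n).
Proof.
elim: n m => [|n IH] m; first by rewrite subn0.
by rewrite iterS coefs_varZ; case: m => [|m] //; rewrite IH.
Qed.

Local Notation dvd := (@dvdL F (deformed H) deformed_var).

Lemma dvd_deformed_varP n (f : deformed H) :
  dvd n f <-> (forall m, (m < n)%N -> coefs f m = 0).
Proof.
split=> [[g ->] m mn|f0]; first by rewrite iter_deformed_var mn.
exists (Fps (fun m => coefs f (m + n)%N)); apply/fpsP => m.
rewrite iter_deformed_var; case: ltnP => [/f0 //|nm /=].
by rewrite subnK.
Qed.

Lemma deformed_complete (u : nat -> deformed H) :
    (forall m, dvd m.+1 (u m.+1 - u m)) ->
  exists h, forall m, dvd m.+1 (h - u m).
Proof.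
(* Diagonal limit: coefficient i no longer changes from u i onwards. *)
move=> uS; exists (Fps (fun i => coefs (u i) i)) => m; apply/dvd_deformed_varP => i.
rewrite ltnS => im /=; apply/eqP; rewrite subr_eq0; apply/eqP.
elim: m im => [|m IH]; first by rewrite leqn0 => /eqP ->.
rewrite leq_eqVlt => /predU1P[-> //|im]; rewrite IH //.
have /dvd_deformed_varP /(_ i im) /= := uS m.
by move/eqP; rewrite subr_eq0 => /eqP.
Qed.

Lemma deformed_separated f : (forall m, dvd m.+1 f) -> f = 0 :> deformed H.
Proof.
by move=> f0; apply/fpsP => m; have /dvd_deformed_varP := f0 m; apply.
Qed.

Lemma deformed_var_inj f : deformed_var f = 0 -> f = 0.
Proof.
move=> f0; apply/fpsP => m.
by have := congr1 (fun h => coefs h m.+1) f0; rewrite coefs_varZ.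
Qed.

Lemma deformed_rho_surj a : exists f, deformed_rho f = a.
Proof. by exists (fpsC a). Qed.

Lemma deformed_rho_var f : deformed_rho (deformed_var f) = 0.
Proof. by rewrite /deformed_rho /deformed_coef coefs_varZ. Qed.

Lemma deformed_rho_ker f : deformed_rho f = 0 -> exists g, f = deformed_var g.
Proof.
move=> f0; exists (fps_shift f); rewrite {1}(fps_split f).
rewrite (_ : fpsC _ = 0) ?add0r //; apply/fpsP => -[|m] //=.
Qed.

End DeformedAlgebra.

(** * From a section of the reduction map to an equivalence *)

Section Trivialization.
Variables (F : numFieldType) (A : algType F) (star : fps A -> fps A -> fps A).
Variables (H : deformation star) (s : {lrmorphism A -> deformed H}).
Hypothesis rho_s : forall a, deformed_rho (s a) = a.

(** The expansion of s in powers of Lambda, as a series of linear maps; the map f |-> sum_m Lambda^m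
    s(f_m) becomes a Cauchy product with it. *)
Let series : fps {linear A -> A} := 
  Fps (fun j => deformed_coef (H := H) j \o s : {linear A -> A}).

Definition extension (f : fps A) : fps A := conv (fun a (T : {linear A -> A}) => T a) f series.
Local Notation Phi := extension.

Let PhiD f g : Phi (f + g) = Phi f + Phi g.
Proof. by apply: convDl => T a b; rewrite linearD. Qed.

Let PhiZ c f : Phi (c *: f) = c *: Phi f.
Proof.
apply/esym; apply: convA => *; rewrite ?scaler0 ?linear0 ?linearZ //.
- exact: scalerDr.
- by move=> ? ?; rewrite linearD.
Qed.

Let PhiC a : Phi (fpsC a) = s a.
Proof. by apply/fpsP => m; rewrite [LHS]conv_fpsCl // => T; rewrite linear0. Qed.

Let starDl f g h : star (f + g) h = star f h + star g h.
Proof. exact: (@mulrDl (deformed H)). Qed.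
Let starDr f g h : star f (g + h) = star f g + star f h.
Proof. exact: (@mulrDr (deformed H)). Qed.
Let starVl f g : star (fps_var F *: f) g = fps_var F *: star f g.
Proof. exact/esym/(@deformed_varMl _ _ _ H). Qed.
Let starVr f g : star f (fps_var F *: g) = fps_var F *: star f g.
Proof. exact/esym/(@deformed_varMr _ _ _ H). Qed.

Let PhiM f g : Phi (f * g) = star (Phi f) (Phi g).
Proof.
move: f; apply: fps_linear_ext => [f f'|f f'|f|f|a].
- by rewrite mulrDl PhiD.
- by rewrite PhiD starDl.
- by rewrite -scalerAl PhiZ.
- by rewrite PhiZ starVl.
move: g; apply: fps_linear_ext => [f f'|f f'|f|f|b].
- by rewrite mulrDr PhiD.
- by rewrite PhiD starDr.
- by rewrite -scalerAr PhiZ.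
- by rewrite PhiZ starVr.
have -> : fpsC a * fpsC b = fpsC (a * b) :> fps A.
  apply/fpsP => m; rewrite [LHS]conv_fpsCl ?[RHS]/=; last exact: mul0r.
  by case: m => //= m; rewrite mulr0.
by rewrite !PhiC; exact: (rmorphM s).
Qed.

Let Phi0 f : coefs (Phi f) 0%N = coefs f 0%N.
Proof. by rewrite /= big_ord_recl big_ord0 addr0; apply: rho_s. Qed.

(** As Phi is the identity modulo Lambda, Phi h = 0 forces h = Lambda h' with Phi h' = 0, and one
    recurses on h'. *)
Let Phi_inj : injective Phi.
Proof.
move=> f g fg; suff : forall m h, Phi h = 0 -> coefs h m = 0.
  move=> h0; apply/eqP; rewrite -subr_eq0; apply/eqP/fpsP => m; apply: h0.
  by rewrite -scaleN1r PhiD PhiZ fg scaleN1r subrr.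
elim=> [|m IH] h h0; first by rewrite -Phi0 h0.
apply: (IH (fps_shift h)); apply: (@deformed_var_inj _ _ _ H).
rewrite /deformed_var -PhiZ -[RHS]h0 [in RHS](fps_split h) -Phi0 h0.
by congr Phi; rewrite (_ : fpsC _ = 0) ?add0r //; apply/fpsP => -[].
Qed.

(** Successive approximation: subtract the image of the constant term, divide by Lambda, repeat. The
    constant terms met on the way are the coefficients of a preimage of g. *)
Let residue (g : fps A) m : fps A :=
  iter m (fun r => fps_shift (r - Phi (fpsC (coefs r 0%N)))) g.

Let Phi_surj g : exists f, Phi f = g.
Proof.
pose r := residue g.
pose f m := Fps (fun i => coefs (r (m + i)%N) 0%N).
(* Iterating this identity shows that the difference is divisible by every power of Lambda. *)
have rS m : r m - Phi (f m) = fps_var F *: (r m.+1 - Phi (f m.+1)).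
  rewrite (fps_split (f m)) PhiD PhiZ opprD addrA scalerBr.
  have -> : fps_shift (f m) = f m.+1.
    by apply/fpsP => i; rewrite /f /fps_shift /= addnS.
  have f0 : coefs (r m - Phi (fpsC (coefs (f m) 0%N))) 0%N = 0.
    rewrite coefsD -[coefs (- _) 0%N]/(- coefs (Phi _) 0%N) Phi0 [coefs (fpsC _) _]/=.
    by rewrite addn0 subrr.
  congr (_ - _); rewrite [LHS]fps_split f0.
  rewrite (_ : fpsC _ = 0); last by apply/fpsP => -[].
  by rewrite add0r [coefs (f m) _]/= addn0.
exists (f 0%N); apply/esym/eqP; rewrite -subr_eq0; apply/eqP/fpsP => i.
rewrite -[g]/(r 0%N); by elim: i 0%N => [|i IH] m; rewrite rS coefs_varZ.
Qed.

Lemma trivial_deformation : equivalent star *%R.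
Proof.
(* The equivalence goes from star to the undeformed product, so it is the inverse of Phi. *)
have /choice [phi phiK] := Phi_surj.
have Kphi f : phi (Phi f) = f by apply: Phi_inj; rewrite phiK.
have phiL : linear phi.
  by move=> c f g; apply: Phi_inj; rewrite phiK PhiD PhiZ !phiK.
have phiM f g : phi (star f g) = phi f * phi g.
  by apply: Phi_inj; rewrite phiK PhiM !phiK.
pose phi_lin : {linear fps A -> fps A} :=
  HB.pack phi (GRing.isLinear.Build (fps F) (fps A) (fps A) *:%R phi phiL).
exists phi_lin; split=> [||e [el er]|f].
- by exists Phi.
- exact: phiM.
- by split=> f; rewrite -[f]Kphi -phiM ?el ?er.
by rewrite -[in RHS](phiK f) Phi0.
Qed.

End Trivialization.

(** * Images of the defining relations under ring morphisms *)

Section MorphismRelations.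
Variables (R S : pzRingType) (f : {rmorphism R -> S}) (u v : R) (m : nat).

Lemma rmorph_anticommutator : f (u * v + v * u) = f u * f v + f v * f u.
Proof. by rewrite rmorphD !rmorphM. Qed.

Lemma rmorph_anticommutatorB :
  f (u * v + v * u - m%:R) = f u * f v + f v * f u - m%:R.
Proof. by rewrite rmorphB rmorph_nat rmorph_anticommutator. Qed.

Lemma rmorph_commutator : f (u * v - v * u) = f u * f v - f v * f u.
Proof. by rewrite rmorphB !rmorphM. Qed.

Lemma rmorph_commutatorB :
  f (u * v - v * u - m%:R) = f u * f v - f v * f u - m%:R.
Proof. by rewrite rmorphB rmorph_nat rmorph_commutator. Qed.

End MorphismRelations.

(** * Rigidity of Clifford-Weyl algebras *)

Section CliffordWeylRigid.
Variables (F : numFieldType) (n k : nat).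
Local Notation A := (clifford_weyl F n k).

Let w i : A := cw_gen F (OmegaIndex k i).
(** The p's and q's form one family, in which the boolean marks the q's and [conj] exchanges p_i
    with q_i. *)
Let x (a : bool * 'I_k) : A :=
  cw_gen F (if a.1 then QIndex n a.2 else PIndex n a.2).
Let conj (a : bool * 'I_k) := (~~ a.1, a.2).
Let sgn (a : bool * 'I_k) : F := if a.1 then -1 else 1.
Let om a b : F := sgn a * (b == conj a)%:R.

Let conjK : involutive conj.
Proof. by case=> b i; rewrite /conj negbK. Qed.

Let sgn2 a : sgn a * sgn a = 1.
Proof. by rewrite /sgn; case: a.1; rewrite ?mulrNN mulr1. Qed.

Let omN a b : om a b = - om b a.
Proof.
case: a b => [[] i] [[] j]; rewrite /om /sgn /conj !xpair_eqE /= ?mulr0 ?oppr0 //.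
  by rewrite mulN1r mul1r eq_sym.
by rewrite mulN1r mul1r opprK eq_sym.
Qed.

Let ww i j : w i * w j + w j * w i = (2 * (i == j))%:R.
Proof.
apply/eqP; rewrite -subr_eq0; apply/eqP.
exact: etrans (esym (rmorph_anticommutatorB _ _ _ _)) (cw_rel_pi (cw_rel_ww F k i j)).
Qed.

Let wx i a : w i * x a = - (x a * w i).
Proof.
apply/eqP; rewrite -addr_eq0; case: a => [[] j]; apply/eqP.
  exact: etrans (esym (rmorph_anticommutator _ _ _)) (cw_rel_pi (cw_rel_wq F i j)).
exact: etrans (esym (rmorph_anticommutator _ _ _)) (cw_rel_pi (cw_rel_wp F i j)).
Qed.

Let xx a b : commutator (x a) (x b) = (om a b)%:A.
Proof.
have pq i j : commutator (x (false, i)) (x (true, j)) = (i == j)%:R.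
  apply/eqP; rewrite -subr_eq0; apply/eqP.
  exact: etrans (esym (rmorph_commutatorB _ _ _ _)) (cw_rel_pi (cw_rel_pq F n i j)).
case: a b => [[] i] [[] j]; rewrite /om /sgn /conj !xpair_eqE /= ?mulr0 ?scale0r.
- exact: etrans (esym (rmorph_commutator _ _ _)) (cw_rel_pi (cw_rel_qq F n i j)).
- rewrite /commutator -opprB -/(commutator _ _) pq mulN1r scaleNr.
  by case: eqP; rewrite ?scale1r ?scale0r.
- by rewrite pq mul1r eq_sym; case: eqP; rewrite ?scale1r ?scale0r.
exact: etrans (esym (rmorph_commutator _ _ _)) (cw_rel_pi (cw_rel_pp F n i j)).
Qed.

Let omegas := [seq w i | i <- enum 'I_n].

Let omegas_involutions : involutions omegas.
Proof.
apply/andP; split.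
  apply/allP => _ /mapP[i _ ->]; have := ww i i.
  rewrite eqxx muln1 -mulr2n -[2%:R]/(1 *+ 2) => /eqP.
  rewrite -subr_eq0 -mulrnBl -scaler_nat scaler_eq0 pnatr_eq0 /= subr_eq0 //.
rewrite pairwise_map; apply: sub_pairwise (_ : pairwise (fun i j => i != j) _).
  move=> i j ij; rewrite /= /anticommute -addr_eq0 ww (negbTE ij) muln0 //.
by rewrite -uniq_pairwise enum_uniq.
Qed.

Let gen (P : A -> Prop) :
  P 1 -> (forall f g, P f -> P g -> P (f + g)) -> (forall c f, P f -> P (c *: f)) ->
  (forall v f, v \in omegas -> P f -> P (v * f)) ->
  (forall a f, P f -> P (x a * f)) -> forall f, P f.
Proof.
move=> P1 PD PZ Pw Px; apply: cw_ind => // -[i|i|i] f Pf.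
- by apply: Pw => //; apply/mapP; exists i; rewrite ?mem_enum.
- exact: (Px (false, i)).
exact: (Px (true, i)).
Qed.

Lemma cw_koszul_exact c : k <> 1%N ->
    koszul_cocycle (fun a => commutator (x a) : {linear A -> A}) c ->
  exists y, forall a b,
    koszul_d (fun a => commutator (x a) : {linear A -> A}) y a b = c a b.
Proof.
move=> k1 cc; case: (ltnP 1 k) => [lt1k|le_k1]; last first.
  (* Here k = 0 and there are no indices. *)
  exists (fun=> 0) => a; exfalso; case: a => _ [i ik].
  by apply: k1; apply/eqP; rewrite eqn_leq le_k1; apply: leq_ltn_trans ik.
pose i0 := Ordinal (ltnW lt1k); pose i1 := Ordinal lt1k.
(* For k >= 2, the generators p_0, q_0, p_1 provide the three distinct indices. *)
apply: (@clifford_weyl_koszul _ _ _ x conj sgn omegas _ _ _ _ _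
  (false, i0) (true, i0) (false, i1)) => //.
by move=> v a /mapP[i _ ->].
Qed.

Lemma clifford_weyl_rigid : k <> 1%N -> rigid A.
Proof.
move=> k1 star H; pose B : algType F := deformed H.
have [|t [g [[tE ti] gx tg gg]]] := @lift_clifford_heisenberg F A B
  (deformed_rho (H := H)) (deformed_var (H := H))
  (@deformed_varMl _ _ _ H) (@deformed_varMr _ _ _ H) (@deformed_var_inj _ _ _ H)
  (@deformed_rho_surj _ _ _ H) (@deformed_rho_var _ _ _ H) (@deformed_rho_ker _ _ _ H)
  (@deformed_complete _ _ _ H) (@deformed_separated _ _ _ H)
  _ x om omegas omegas_involutions _ xx omN (fun c => @cw_koszul_exact c k1).
  by move=> a; apply/allP => _ /mapP[i _ ->]; apply/eqP.
have sz : size t = n by rewrite -(size_map (@deformed_rho F A star H)) tE size_map size_enum_ord.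
(* The lifted generators, which satisfy the defining relations in B. *)
pose h (u : cw_index n k) : B := match u with
  | OmegaIndex i => nth 0 t i | PIndex i => g (false, i) | QIndex i => g (true, i) end.
have t_mem (i : 'I_n) : nth 0 t i \in t by rewrite mem_nth // sz.
have tg' (i : 'I_n) a : nth 0 t i * g a = - (g a * nth 0 t i).
  exact: (eqP (allP (tg a) _ (t_mem i))).
have tt (i j : 'I_n) : nth 0 t i * nth 0 t j + nth 0 t j * nth 0 t i = (2 * (i == j))%:R.
  have [ti1 /(pairwiseP 0) tij] := andP ti.
  have tN (u v : 'I_n) : (u < v)%N -> nth 0 t u * nth 0 t v = - (nth 0 t v * nth 0 t u).
    by move=> uv; apply/eqP; apply: tij => //; rewrite inE sz.
  have [<-|ij] := eqVneq i j.
    by rewrite (eqP (allP ti1 _ (t_mem i))) muln1.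
  rewrite muln0; case: (ltngtP i j) => [/tN->|/tN->|/val_inj ji].
  - by rewrite addNr.
  - by rewrite addrN.
  by rewrite ji eqxx in ij.
have hr r : cw_rel r -> free_eval h r = 0.
  case=> i j.
  - apply: etrans (rmorph_anticommutatorB _ _ _ _) _.
    by rewrite /= /cw_omega /cw_p /cw_q !free_eval_gen tt subrr.
  - apply: etrans (rmorph_commutatorB _ _ _ _) _.
    rewrite /= /cw_omega /cw_p /cw_q !free_eval_gen
      [X in X - _](gg (false, i) (true, j)) /om /sgn /conj.
    rewrite !xpair_eqE /= mul1r eq_sym; case: eqP => _.
      by rewrite scale1r subrr.
    by rewrite scale0r subrr.
  - apply: etrans (rmorph_commutator _ _ _) _.
    rewrite /= /cw_omega /cw_p /cw_q !free_eval_gen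
      [LHS](gg (false, i) (false, j)) /om /conj xpair_eqE /=.
    by rewrite mulr0 scale0r.
  - apply: etrans (rmorph_commutator _ _ _) _.
    rewrite /= /cw_omega /cw_p /cw_q !free_eval_gen
      [LHS](gg (true, i) (true, j)) /om /conj xpair_eqE /=.
    by rewrite mulr0 scale0r.
  - apply: etrans (rmorph_anticommutator _ _ _) _.
    by rewrite /= /cw_omega /cw_p /cw_q !free_eval_gen tg' addNr.
  - apply: etrans (rmorph_anticommutator _ _ _) _.
    by rewrite /= /cw_omega /cw_p /cw_q !free_eval_gen tg' addNr.
have [s sE] := cw_lift hr.
(* That s is a section of [deformed_rho] is checked on the generators. *)
apply: (@trivial_deformation _ _ _ H s); apply: cw_ind => [|u v uE vE|c u uE|u v vE].
- by rewrite !rmorph1.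
- by rewrite !linearD /= uE vE.
- by rewrite !linearZ /= uE.
rewrite !rmorphM /= vE sE; congr (_ * _); case: u => i /=; rewrite ?gx //.
rewrite -(nth_map 0 0) ?sz // tE (nth_map i) ?size_enum_ord //.
by rewrite nth_ord_enum.
Qed.

End CliffordWeylRigid.

Theorem corollary5p4 (R : realType) (n k : nat) :
  k <> 1%N -> rigid (clifford_weyl R[i] (2 * n + 1) k).
Proof. exact: clifford_weyl_rigid. Qed.
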